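(* Let $d\geq 5$. There exists a function $\delta:(0,\infty)\to(0,\infty)$, depending only on $d$ (so that $\delta(\gamma)$ is a positive constant depending only on $d$ and $\gamma$), with $\delta(\gamma)\to 0$ as $\gamma\to 0$, such that the following holds for every $\gamma>0$ and every law $\mathbb{Q}$ of i.i.d. random conductances on the nearest-neighbor bonds of $\mathbb{Z}^d$ with values in $(0,1]$ satisfying $\mathbb{Q}(\omega_b\leq a)\sim a^{\gamma}$ as $a\downarrow 0$: for $\mathbb{Q}$-almost every $\omega$ there exists a constant $C=C(\omega)\in(0,\infty)$ such that for all $n\geq 1$ $$P_\omega^{2n}(0,0)\geq \frac{C(\omega)}{n^{2+\delta(\gamma)}}.$$
   Context: Write $x\sim y$ if $x,y\in\mathbb{Z}^d$ are nearest neighbors. An environment is a family $\omega=(\omega_{xy})_{x,y\in\mathbb{Z}^d}$ of nonnegative numbers (conductances) with $\omega_{xy}=\omega_{yx}$ and $\omega_{xy}>0$ if and only if $x\sim y$; for an unordered nearest-neighbor pair (bond) $b=\{x,y\}$ write $\omega_b=\omega_{xy}$. Under the probability measure $\mathbb{Q}$ the family $(\omega_b)$, $b$ ranging over the bonds of $\mathbb{Z}^d$, is i.i.d. The notation $\mathbb{Q}(\omega_b\le a)\sim a^\gamma$ as $a\downarrow 0$ means that the ratio of the two sides tends to $1$. Given $\omega$, let $\pi_\omega(x)=\sum_{y}\omega_{xy}$ and let $P_\omega(x,y)=\omega_{xy}/\pi_\omega(x)$ be the transition matrix of the discrete-time random walk in the environment $\omega$; $P_\omega^n(x,y)$ denotes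 its $n$-step transition probability. *)

(* Defs.v *)
From HB Require Import structures.
From mathcomp Require Import all_boot all_order all_algebra finmap zify.
From mathcomp Require Import all_classical all_reals all_analysis.

Set Implicit Arguments.
Unset Strict Implicit.
Unset Printing Implicit Defensive.

Import Order.TTheory GRing.Theory Num.Theory.
Import numFieldNormedType.Exports.

Local Open Scope classical_set_scope.
Local Open Scope ring_scope.

Notation Zd d := 'rV[int]_d (only parsing).

Definition nearest_neighbor (d : nat) (x y : Zd d) : bool :=
  \sum_(i < d) `|x 0 i - y 0 i| == 1.

(* The bond (x, i) stands for the unordered pair {x, x + e_i}: every unordered
   nearest-neighbor pair is represented exactly once (see [bond_existence] and
   [bond_unique]). *)
Notation bond d := (Zd d * 'I_d)%type (only parsing).

Definition bond_end (d : nat) (b : bond d) : Zd d :=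
  b.1 + delta_mx 0 b.2.

Section bonds.
Variable d : nat.
Implicit Types (x y : Zd d) (b : bond d).

Lemma nearest_neighbor_bond b : nearest_neighbor b.1 (bond_end b).
Proof.
rewrite /nearest_neighbor /bond_end (bigD1 b.2)//= big1 => [|i /negPf ib].
  by rewrite !mxE !eqxx/= opprD addrA subrr sub0r normrN normr1 addr0.
by rewrite !mxE ib andbF addr0 subrr normr0.
Qed.

Lemma bond_existence x y : nearest_neighbor x y ->
  exists b, (b.1 = x /\ bond_end b = y) \/ (b.1 = y /\ bond_end b = x).
Proof.
move=> /eqP xy.
have [i xyi] : exists i, x 0 i - y 0 i != 0.
  apply/existsP; apply: contraPT xy => /existsPn xy0.
  by rewrite big1// => i _; apply/eqP; have := xy0 i; rewrite negbK normr_eq0.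
have := xy; rewrite (bigD1 i)//= => xyD.
have n1 : 1 <= `|x 0 i - y 0 i| by rewrite -gtz0_ge1 normr_gt0.
have rest_ge0 : 0 <= \sum_(j < d | j != i) `|x 0 j - y 0 j| by exact: sumr_ge0.
have [ni rest0] : `|x 0 i - y 0 i| = 1 /\
    \sum_(j < d | j != i) `|x 0 j - y 0 j| = 0.
  by move: n1 rest_ge0 xyD; set r := bigop _ _ _; set n := `|_|; lia.
have eqj j : j != i -> x 0 j = y 0 j.
  move=> ji; apply/eqP; rewrite -subr_eq0 -normr_eq0; apply/eqP.
  by apply: (psumr_eq0P _ rest0).
have [e|e] : y 0 i = x 0 i + 1 \/ x 0 i = y 0 i + 1 by lia.
- exists (x, i); left; split => //; apply/rowP => j; rewrite !mxE eqxx/=.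
  by have [->|/eqj ->] := eqVneq j i; rewrite ?e ?addr0.
- exists (y, i); right; split => //; apply/rowP => j; rewrite !mxE eqxx/=.
  by have [->|/eqj ->] := eqVneq j i; rewrite ?e ?addr0.
Qed.

Lemma bond_unique b b' :
  [set b.1; bond_end b] = [set b'.1; bond_end b'] -> b = b'.
Proof.
case: b b' => [x i] [y j]; rewrite /bond_end/= => E.
have eD (z : Zd d) k : z + delta_mx 0 k <> z.
  move=> /rowP/(_ k); rewrite !mxE !eqxx/=; lia.
have : [set x; x + delta_mx 0 i] x by left.
have : [set x; x + delta_mx 0 i] (x + delta_mx 0 i) by right.
rewrite E => -[xiy|xiyj] [xy|xyj].
- by case: (eD x i); rewrite xiy.
- move: xiy; rewrite xyj -addrA => /rowP/(_ i); rewrite !mxE !eqxx/=.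
  by case: (i == j); lia.
- move: xiyj; rewrite xy => /addrI /rowP/(_ i); rewrite !mxE !eqxx/=.
  by have [->|] := eqVneq i j.
- by case: (eD x i); rewrite xiyj.
Qed.

End bonds.

Section environment.
Context {R : realType} {d : nat}.

Definition environment (w : Zd d -> Zd d -> R) : Prop :=
  [/\ forall x y, 0 <= w x y,
      forall x y, w x y = w y x &
      forall x y, (0 < w x y) = nearest_neighbor x y].

Variable w : Zd d -> Zd d -> R.

(* [\sum_(y \in A)] is the sum over the finite support of the summand; for an
   environment it involves only the 2d nearest neighbors of x. *)
Definition total_conductance (x : Zd d) : R := \sum_(y \in setT) w x y.

Definition transition (x y : Zd d) : R := w x y / total_conductance x.

Fixpoint transition_n (n : nat) (x y : Zd d) : R :=
  if n is m.+1 then \sum_(z \in setT) transition x z * transition_n m z y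
  else (x == y)%:R.

End environment.

Section conductance_law.
Context {R : realType} {d : nat} {disp : measure_display}
  {T : measurableType disp}.
Variables (Q : probability T R) (omega : T -> Zd d -> Zd d -> R).

Definition conductance (b : bond d) (t : T) : R := omega t b.1 (bond_end b).

Definition mutually_independent (I : choiceType) (X : I -> T -> R) : Prop :=
  forall (J : {fset I}) (B : I -> set R), (forall i, measurable (B i)) ->
    Q (\bigcap_(i in [set` J]) (X i @^-1` B i)) =
    (\prod_(i <- J) Q (X i @^-1` B i))%E.

Definition identically_distributed (I : Type) (X : I -> T -> R) : Prop :=
  forall (i j : I) (B : set R), measurable B ->
    Q (X i @^-1` B) = Q (X j @^-1` B).

Definition iid_conductances : Prop :=
  [/\ forall t, environment (omega t),
      forall b, measurable_fun setT (conductance b),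
      mutually_independent conductance &
      identically_distributed conductance].

Definition conductances_in_01 : Prop :=
  forall b, {ae Q, forall t, 0 < conductance b t <= 1}.

Definition lower_tail (gamma : R) : Prop :=
  forall b, fine (Q [set t | conductance b t <= a]) / a `^ gamma
    @[a --> 0^'+] --> (1 : R).

End conductance_law.

(* Main.v *)
Require Import Defs.
From HB Require Import structures.
From mathcomp Require Import all_boot all_order all_algebra finmap zify ring lra.
From mathcomp Require Import all_classical all_reals all_analysis measurable_realfun.

Set Implicit Arguments.
Unset Strict Implicit.
Unset Printing Implicit Defensive.

Import Order.TTheory GRing.Theory Num.Theory.
Import numFieldNormedType.Exports.

Local Open Scope classical_set_scope.
Local Open Scope ring_scope.

(** A trap at scale N is a bond with conductance of order 1, all of whose
adjacent bonds have conductance of order 1/N. A walk at the entrance of a trap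
steps into it with probability of order 1/N, and from then on it stays inside
for a time of order N with a probability bounded below. Suppose that the walk
started at 0 meets the entrance of a trap within distance r of 0 before time
n, where n is comparable to N. Then the probability that the walk is at
distance at most r + 2 from 0 at time n is at least c/n ([hit_le_iter],
[trap_ball_ge]), although such a ball would usually have been left long ago.
By reversibility and Cauchy-Schwarz, P^{2n}(0,0) is at least a constant times
the square of this probability divided by r^d ([return_ge_sqr_ball]), that is,
at least c n^{-2} r^{-d}. A trap has probability N^{-O(gamma)}, so that r can
be taken to be N^{O(gamma)}, and r^{-d} is a negligible loss when gamma is
small. When gamma is not small, the ball of radius n, which the walk cannot
leave in n steps, gives a lower bound of order n^{-d}, which is enough since
only the behaviour of delta near 0 is prescribed.

That the walk meets a trap in time rests on three estimates.

Averaged over the environment, the walk meets a trap. When it first reaches the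
sphere of radius 3j, the bonds outside have not been explored, so the point
reached is the entrance of a trap lying just outside with probability at least
q = N^{-O(gamma)}, independently of the past. The averaged probability of
reaching the sphere of radius 3J without meeting an entrance is at most
(1 - q)^J ([integral_reach_le]), which is small when J is a larger power of
N^gamma than 1/q.

For a fixed environment, the walk leaves the ball of radius r quickly. By
reversibility and the maximum principle, Green's function of the walk killed
outside the ball is bounded by its value at 0, which is an effective resistance
between 0 and the outside; hence the expected exit time is at most the volume
times the resistance ([survival_le_resistance]). Deep traps inside the ball do
no harm, because they are rarely entered.

The resistance is small. Call a bond open when its conductance exceeds
N^{-1/2}. Closed bonds have density N^{-gamma/2}, and blocking a strip of width
W in a coordinate plane requires W of them in a bounded region; for a suitable
W depending only on d, this does not happen along a strip of length
N^{O(gamma)} ([strip_open_prob]), and the resistance is at most the length of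
an open path times N^{1/2} ([resistance_strip]).

Along N = 4^i all failure probabilities are geometric in i
([scale_event]), and the Borel-Cantelli lemma concludes. *)

(** * The lattice *)

Section lattice.
Context {d : nat}.
Implicit Types (x y : Zd d) (u : 'I_d * bool).

Definition step u : Zd d :=
  if u.2 then delta_mx 0 u.1 else - delta_mx 0 u.1.

Definition opposite u : 'I_d * bool := (u.1, ~~ u.2).

(** The bond between x and x + step u, in the orientation used for bonds. *)
Definition bond_at x u : bond d := (if u.2 then x else x + step u, u.1).

Lemma stepN u : step (opposite u) = - step u.
Proof. by case: u => i []; rewrite /step /= ?opprK. Qed.

Lemma addr_stepK x u : x + step u + step (opposite u) = x.
Proof. by rewrite stepN addrK. Qed.

Lemma step_inj : injective step.
Proof.
move=> [i s] [j s'] /rowP E.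
have := E i; have := E j; rewrite /step /=.
by have [->|ij] := eqVneq i j; case: s E; case: s' => // _;
   rewrite !mxE ?eqxx/= ?(negPf ij) ?(eq_sym j) ?(negPf ij)//=; lia.
Qed.

Lemma bond_at_ends x u :
  ((bond_at x u).1 = x /\ bond_end (bond_at x u) = x + step u) \/
  ((bond_at x u).1 = x + step u /\ bond_end (bond_at x u) = x).
Proof.
by case: u => i []; [left|right]; rewrite /bond_at /bond_end /step //= subrK.
Qed.

Lemma bond_at_opposite x u : bond_at (x + step u) (opposite u) = bond_at x u.
Proof.
case: u => i []; rewrite /bond_at /step /opposite /= ?addrK//.
Qed.

Lemma bond_at_inj x : injective (bond_at x).
Proof.
move=> u v E; apply: step_inj; move: E.
case: u v => i [] [j []] //=; rewrite /bond_at /=.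
- by case=> ->.
- case=> + _ => /(congr1 (fun z => z - x)); rewrite subrr addrC addrA addNr add0r.
  by move=> /rowP/(_ j); rewrite /step !mxE/= !eqxx.
- case=> + _ => /(congr1 (fun z => z - x)); rewrite subrr addrC addrA addNr add0r.
  by move=> /rowP/(_ i); rewrite /step !mxE/= !eqxx.
- by case=> _ ->.
Qed.

Lemma nearest_neighbor_sym x y : nearest_neighbor x y = nearest_neighbor y x.
Proof. by rewrite /nearest_neighbor; under eq_bigr do rewrite distrC. Qed.

Lemma nearest_neighbor_step x u : nearest_neighbor x (x + step u).
Proof.
case: (bond_at_ends x u) (nearest_neighbor_bond (bond_at x u)) => -[-> ->] //.
by rewrite nearest_neighbor_sym.
Qed.

Lemma nearest_neighborP x y :
  nearest_neighbor x y -> exists u, y = x + step u.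
Proof.
move=> /bond_existence[[z i] [[/= <- <-]|[/= <- <-]]].
- by exists (i, true).
- by exists (i, false); rewrite /step /bond_end /= addrK.
Qed.

Definition supnorm x : nat := \max_(i < d) `|x 0%R i|%N.

Lemma supnorm_leP x n : (forall i, `|x 0%R i|%N <= n)%N <-> (supnorm x <= n)%N.
Proof. by split=> [h|/bigmax_leqP h i]; [apply/bigmax_leqP|exact: h]. Qed.

Lemma abs_step_le x u i : (absz ((x + step u)%R 0%R i) <= absz (x 0%R i) + 1)%N.
Proof.
rewrite /step !mxE; case: u => j [] /=; rewrite !mxE; case: (i == j) => /=; lia.
Qed.

Lemma supnorm_step_le x u : (supnorm (x + step u)%R <= (supnorm x).+1)%N.
Proof.
apply/supnorm_leP => i; apply: leq_trans (abs_step_le _ _ _) _.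
by rewrite addn1 ltnS; exact: (iffRL (supnorm_leP x _)).
Qed.

Lemma supnorm0 : supnorm 0 = 0%N.
Proof. by apply/eqP; rewrite -leqn0; apply/supnorm_leP => i; rewrite mxE. Qed.

(** A direction in which a step from x increases the sup norm; it remains one
after the step, so that it can be used twice. *)
Definition outward x u : bool :=
  (`|x 0%R u.1|%N == supnorm x) && (if u.2 then 0 <= x 0 u.1 else x 0 u.1 <= 0).

Lemma outward_exists x : (0 < d)%N -> exists u, outward x u.
Proof.
move=> d0; have [i xi] : {i | supnorm x = `|x 0%R i|%N}.
  by apply: (@bigop.eq_bigmax _ (fun i => absz (x 0%R i))); rewrite card_ord.
exists (i, 0 <= x 0 i); rewrite /outward xi eqxx /=.
by case: lerP => // /ltW.
Qed.

Lemma outward_step x u : outward x u ->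
  supnorm (x + step u) = (supnorm x).+1 /\ outward (x + step u) u.
Proof.
move=> /andP[/eqP xu su].
have E : `|(x + step u)%R 0%R u.1|%N = (supnorm x).+1.
  rewrite -xu /step; case: u su {xu} => i [] /=; rewrite !mxE !eqxx /=; lia.
have S : supnorm (x + step u) = (supnorm x).+1.
  apply/eqP; rewrite eqn_leq supnorm_step_le -E /=.
  exact: (iffRL (supnorm_leP _ _)).
split=> //; rewrite /outward S E eqxx /=.
by rewrite /step; case: u su {xu E S} => i [] /=; rewrite !mxE !eqxx /=; lia.
Qed.

(** The points of the ball of radius r, parametrised by a finite type so that
sums over the ball are ordinary finite sums. *)
Definition ball_point r (m : 'rV['I_(2 * r).+1]_d) : Zd d :=
  \row_i ((m 0 i : nat)%:Z - r%:Z).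

Lemma ball_point_inj r : injective (@ball_point r).
Proof.
move=> m m' /rowP E; apply/rowP => i; apply/val_inj => /=.
by have := E i; rewrite !mxE; lia.
Qed.

Lemma supnorm_ball_point r m : (supnorm (@ball_point r m) <= r)%N.
Proof.
by apply/supnorm_leP => i; rewrite mxE; have := ltn_ord (m 0 i); lia.
Qed.

Lemma ball_pointP r x : (supnorm x <= r)%N -> exists m, x = @ball_point r m.
Proof.
move=> /supnorm_leP xr.
have h i : (`|(x 0%R i + r%:Z)%R| < (2 * r).+1)%N by have := xr i; lia.
exists (\row_i Ordinal (h i)); apply/rowP => i; rewrite !mxE /=.
by have := xr i; lia.
Qed.

Lemma card_ball r : #|'rV['I_(2 * r).+1]_d| = ((2 * r).+1 ^ d)%N.
Proof. by rewrite card_mx card_ord mul1n. Qed.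

End lattice.

Section ball_sums.
Context {R : realType} {d : nat}.

Lemma sum_ball_point r (F : Zd d -> R) x : (supnorm x <= r)%N ->
  \sum_m (x == @ball_point d r m)%:R * F (@ball_point d r m) = F x.
Proof.
move=> /ball_pointP[m ->]; rewrite (bigD1 m)//= eqxx mul1r big1 ?addr0// => m' mm'.
by rewrite (inj_eq (@ball_point_inj d r)) eq_sym (negPf mm') mul0r.
Qed.

Lemma sum_ball_point_out r (F : Zd d -> R) x : (r < supnorm x)%N ->
  \sum_m (x == @ball_point d r m)%:R * F (@ball_point d r m) = 0.
Proof.
move=> xr; rewrite big1// => m _; case: eqP => [xm|_]; last by rewrite mul0r.
by move: xr; rewrite xm ltnNge supnorm_ball_point.
Qed.

(** Turns the sums over all of Z^d in the definition of the walk into sums over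
the 2d directions. *)
Lemma sum_neighbors (F : Zd d -> R) x :
  (forall y, ~~ nearest_neighbor x y -> F y = 0) ->
  \sum_(y \in setT) F y = \sum_u F (x + step u).
Proof.
move=> F0; pose r : seq (Zd d) := [seq x + step u | u <- enum {: 'I_d * bool}].
have Ur : uniq r by rewrite map_inj_uniq ?enum_uniq// => u v /addrI /step_inj.
have r0 (y : Zd d) : setT y -> y \notin r -> F y = 0.
  move=> _ ny; apply: F0; apply/negP => /nearest_neighborP[u yu].
  by move/negP: ny; apply; apply/mapP; exists u => //; rewrite mem_enum.
rewrite (fsbigE r F Ur _ r0)// big_map big_enum_cond.
by apply: eq_bigl => u; rewrite in_setT andbT.
Qed.
End ball_sums.

(** * The walk, reversibility and return probabilities *)

Section walk.
Context {R : realType} {d : nat}.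
Variable w : Zd d -> Zd d -> R.
Implicit Types (x y z : Zd d) (u : 'I_d * bool) (h k V : Zd d -> R).

(** The transition operator on functions: h is averaged over one step. *)
Definition averaging h x : R := \sum_u transition w x (x + step u) * h (x + step u).

Definition dirac_fun y x : R := (x == y)%:R.

(** One step of the walk which survives its arrival at y with probability k y. *)
Definition killed k h : Zd d -> R := averaging (fun y => k y * h y).

Definition killed_kernel k n x y : R := iter n (killed k) (dirac_fun y) x.

Hypothesis d_gt0 : (0 < d)%N.
Hypothesis env_w : environment w.

Lemma env_ge0 x y : 0 <= w x y. Proof. by case: env_w. Qed.
Lemma env_sym x y : w x y = w y x. Proof. by case: env_w. Qed.
Lemma env_step_gt0 x u : 0 < w x (x + step u).
Proof. by case: env_w => _ _ ->; exact: nearest_neighbor_step. Qed.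

Lemma env_far x y : ~~ nearest_neighbor x y -> w x y = 0.
Proof.
case: env_w => w0 _ wP; rewrite -wP -leNgt => h.
by apply/eqP; rewrite eq_le h w0.
Qed.

Lemma total_conductanceE x : total_conductance w x = \sum_u w x (x + step u).
Proof. by apply: sum_neighbors => y; exact: env_far. Qed.

Lemma le_total_conductance x u : w x (x + step u) <= total_conductance w x.
Proof.
rewrite total_conductanceE (bigD1 u)//= lerDl.
by apply: sumr_ge0 => v _; exact: env_ge0.
Qed.

Lemma total_conductance_gt0 x : 0 < total_conductance w x.
Proof.
by apply: lt_le_trans (le_total_conductance x (Ordinal d_gt0, true)); exact: env_step_gt0.
Qed.

Lemma transition_ge0 x y : 0 <= transition w x y.
Proof. by rewrite divr_ge0 ?env_ge0// ltW// total_conductance_gt0. Qed.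

Lemma transition_sum1 x : \sum_u transition w x (x + step u) = 1.
Proof.
rewrite -mulr_suml -total_conductanceE divff// gt_eqF//.
exact: total_conductance_gt0.
Qed.

Lemma transition_reversible x y :
  total_conductance w x * transition w x y = total_conductance w y * transition w y x.
Proof.
rewrite /transition !(mulrC _ (_ / _)) !divfK ?gt_eqF ?total_conductance_gt0//.
exact: env_sym.
Qed.

Lemma transition_nE n x y : transition_n w n x y = iter n averaging (dirac_fun y) x.
Proof.
elim: n x => [//|n IH] x /=; rewrite /averaging.
under [RHS]eq_bigr do rewrite -IH.
apply: (sum_neighbors (F := fun z => transition w x z * transition_n w n z y)) => z xz.
by rewrite /transition env_far// !mul0r.
Qed.

Lemma averaging_le h h' x : (forall u, h (x + step u) <= h' (x + step u)) ->
  averaging h x <= averaging h' x.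
Proof. by move=> hh; apply: ler_sum => u _; rewrite ler_wpM2l// transition_ge0. Qed.

Lemma averaging_ge0 h x : (forall y, 0 <= h y) -> 0 <= averaging h x.
Proof. by move=> h0; apply: sumr_ge0 => u _; rewrite mulr_ge0// transition_ge0. Qed.

Lemma averaging_cst c x : averaging (fun=> c) x = c.
Proof. by rewrite /averaging -mulr_suml transition_sum1 mul1r. Qed.

Lemma averagingD h h' x : averaging (fun y => h y + h' y) x = averaging h x + averaging h' x.
Proof. by rewrite /averaging -big_split /=; apply: eq_bigr => u _; rewrite mulrDr. Qed.

Lemma averagingZ c h x : averaging (fun y => c * h y) x = c * averaging h x.
Proof. by rewrite /averaging mulr_sumr; apply: eq_bigr => u _; rewrite mulrCA. Qed.

Lemma averaging_ext h h' x : (forall u, h (x + step u) = h' (x + step u)) ->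
  averaging h x = averaging h' x.
Proof. by move=> hh; apply: eq_bigr => u _; rewrite hh. Qed.

Lemma averaging_sum (I : finType) (c : I -> R) (h : I -> Zd d -> R) x :
  averaging (fun y => \sum_i c i * h i y) x = \sum_i c i * averaging (h i) x.
Proof.
rewrite /averaging; under eq_bigr do rewrite mulr_sumr.
rewrite exchange_big /=; apply: eq_bigr => i _; rewrite mulr_sumr.
by apply: eq_bigr => u _; rewrite mulrCA.
Qed.

Lemma iter_averaging_le n h h' : (forall y, h y <= h' y) ->
  forall x, iter n averaging h x <= iter n averaging h' x.
Proof. by move=> hh; elim: n => //= n IH x; apply: averaging_le => u; exact: IH. Qed.

Lemma iter_averaging_ge0 n h : (forall y, 0 <= h y) ->
  forall x, 0 <= iter n averaging h x.
Proof. by move=> hh; elim: n => //= n IH x; exact: averaging_ge0. Qed.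

Lemma killed1 h : killed (fun=> 1) h = averaging h.
Proof. by apply/funext => x; apply: averaging_ext => u; rewrite mul1r. Qed.

Lemma iter_killed_sum k n (I : finType) (c : I -> R) (h : I -> Zd d -> R) x :
  iter n (killed k) (fun y => \sum_i c i * h i y) x =
  \sum_i c i * iter n (killed k) (h i) x.
Proof.
elim: n x => //= n IH x; rewrite /killed -averaging_sum.
apply: averaging_ext => u; rewrite IH mulr_sumr.
by apply: eq_bigr => i _; rewrite mulrCA.
Qed.

Lemma iter_killed_ge0 k n h : (forall y, 0 <= k y) -> (forall y, 0 <= h y) ->
  forall x, 0 <= iter n (killed k) h x.
Proof.
by move=> k0 hh; elim: n => //= n IH x; apply: averaging_ge0 => y; rewrite mulr_ge0.
Qed.

(** Decomposition according to the last step, whereas the definition iterates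
from the first step; reversibility exchanges the two. *)
Lemma killed_kernelSr k n x y : killed_kernel k n.+1 x y =
  \sum_u transition w (y + step u) y * k y * killed_kernel k n x (y + step u).
Proof.
rewrite /killed_kernel iterSr -iter_killed_sum; congr (iter n _ _ x).
apply/funext => z; rewrite /killed /averaging /dirac_fun.
case: (boolP (nearest_neighbor z y)) => [/nearest_neighborP[u yE]|zy].
  rewrite (bigD1 u)//= [RHS](bigD1 (opposite u))//= -yE eqxx yE addr_stepK eqxx !mulr1.
  rewrite !big1 ?addr0// => v vu.
  - case: eqP => [E|_]; last by rewrite mulr0.
    case/eqP: vu; apply: step_inj; apply: (addrI (z + step u)).
    by rewrite stepN addrK -E.
  - case: eqP => [/addrI/step_inj E|_]; last by rewrite !mulr0.
    by rewrite E eqxx in vu.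
rewrite !big1// => u _; case: eqP => [E|_]; rewrite ?mulr0//.
- by move: zy; rewrite E nearest_neighbor_sym nearest_neighbor_step.
- by move: zy; rewrite -E nearest_neighbor_step.
Qed.

Lemma killed_kernel_sym k n x y :
  total_conductance w x * k x * killed_kernel k n x y =
  total_conductance w y * k y * killed_kernel k n y x.
Proof.
elim: n x y => [|n IH] x y.
  rewrite /killed_kernel /= /dirac_fun (eq_sym y).
  by case: eqP => [->//|_]; rewrite !mulr0.
rewrite killed_kernelSr {2}/killed_kernel /= -/(killed_kernel _ _ _ _).
rewrite {2}/killed /averaging !mulr_sumr; apply: eq_bigr => u _.
rewrite -[iter _ _ _ _]/(killed_kernel k n (y + step u) x).
transitivity (transition w (y + step u) y * k y *
   (total_conductance w x * k x * killed_kernel k n x (y + step u))); first ring.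
rewrite IH; transitivity (k y * k (y + step u) * killed_kernel k n (y + step u) x *
  (total_conductance w (y + step u) * transition w (y + step u) y)); first ring.
by rewrite transition_reversible; ring.
Qed.

Lemma transition_n_sym n x y :
  total_conductance w x * transition_n w n x y =
  total_conductance w y * transition_n w n y x.
Proof.
have := killed_kernel_sym (fun=> 1) n x y; rewrite /killed_kernel.
rewrite (_ : killed (fun=> 1) = averaging); last by apply/funext => h; exact: killed1.
by rewrite !mulr1 !transition_nE.
Qed.

Definition ball_ind (r : nat) x : R := (supnorm x <= r)%N%:R.

Lemma ball_ind_sum r x : ball_ind r x = \sum_m 1 * dirac_fun (@ball_point d r m) x.
Proof.
under eq_bigr do rewrite mul1r -[dirac_fun _ _]mulr1.
rewrite /dirac_fun /ball_ind.
have [xr|xr] := leqP (supnorm x) r.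
  by rewrite (sum_ball_point (fun=> 1) xr).
by rewrite (sum_ball_point_out (fun=> 1) xr).
Qed.

Lemma iter_averaging_ball n r x :
  iter n averaging (ball_ind r) x = \sum_m transition_n w n x (@ball_point d r m).
Proof.
have := iter_killed_sum (fun=> 1) n (fun _ : 'rV_d => 1) (fun m => dirac_fun (@ball_point d r m)) x.
rewrite (_ : killed (fun=> 1) = averaging); last by apply/funext => h; exact: killed1.
rewrite (_ : (fun y => _) = ball_ind r) => [->|]; last first.
  by apply/funext => y; rewrite ball_ind_sum.
by apply: eq_bigr => m _; rewrite mul1r transition_nE.
Qed.

Lemma transition_n_ge0 n x y : 0 <= transition_n w n x y.
Proof. by rewrite transition_nE; apply: iter_averaging_ge0 => z; exact: ler0n. Qed.

(** The Chapman-Kolmogorov sum over the position at time n, of which only the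
part in a ball is kept. *)
Lemma chapman_kolmogorov_ball n r :
  \sum_m transition_n w n 0 (@ball_point d r m) * transition_n w n (@ball_point d r m) 0
  <= transition_n w (2 * n) 0 0.
Proof.
rewrite transition_nE [in leRHS]mul2n -addnn iterD.
set f := iter n averaging (dirac_fun 0).
pose g x := \sum_m f (@ball_point d r m) * dirac_fun (@ball_point d r m) x.
have gf x : g x <= f x.
  rewrite /g (eq_bigr (fun m => (x == @ball_point d r m)%:R * f (@ball_point d r m))); last first.
    by move=> m _; rewrite mulrC.
  have [xr|xr] := leqP (supnorm x) r; first by rewrite sum_ball_point.
  by rewrite sum_ball_point_out// /f -transition_nE transition_n_ge0.
apply: le_trans (iter_averaging_le n gf 0).
have := iter_killed_sum (fun=> 1) n (fun m => f (@ball_point d r m)) (fun m => dirac_fun (@ball_point d r m)) 0.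
rewrite (_ : killed (fun=> 1) = averaging); last by apply/funext => h; exact: killed1.
move=> ->; apply: ler_sum => m _.
by rewrite -transition_nE mulrC /f -transition_nE.
Qed.

Lemma sqr_sum_le (I : finType) (a : I -> R) :
  (\sum_i a i) ^+ 2 <= #|I|%:R * \sum_i (a i) ^+ 2.
Proof.
rewrite expr2 big_distrlr /=.
have -> : #|I|%:R * \sum_i a i ^+ 2 = \sum_i \sum_j (a i ^+ 2 + a j ^+ 2) / 2.
  transitivity (\sum_(i : I) ((#|I|%:R * a i ^+ 2 + \sum_j a j ^+ 2) / 2)); last first.
    apply: eq_bigr => i _; rewrite -mulr_suml big_split /= sumr_const.
    by rewrite cardT -cardE mulr_natl.
  rewrite -mulr_suml big_split /= sumr_const -mulr_sumr -[_ *+ #|_|]mulr_natl.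
  by field.
apply: ler_sum => i _; apply: ler_sum => j _.
by rewrite ler_pdivlMr//; have := sqr_ge0 (a i - a j); rewrite !expr2; nra.
Qed.

(** By reversibility P^{2n}(0,0) is a weighted sum of squares P^n(0,x)^2, and
Cauchy-Schwarz over the ball bounds it by the square of a probability. Thanks to
the square, only the way from 0 into a trap has to be controlled, and not the
way back. *)
Lemma return_ge_sqr_ball (hw : forall x, total_conductance w x <= (2 * d)%:R) n r :
  total_conductance w 0 / (2 * d)%:R *
    iter n averaging (ball_ind r) 0 ^+ 2 / ((2 * r).+1 ^ d)%:R
  <= transition_n w (2 * n) 0 0.
Proof.
apply: le_trans (chapman_kolmogorov_ball n r).
have c0 : 0 < ((2 * r).+1 ^ d)%:R :> R by rewrite ltr0n expn_gt0.
rewrite ler_pdivrMr// iter_averaging_ball.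
set a := fun m => transition_n w n 0 (@ball_point d r m).
have h : (\sum_m a m) ^+ 2 <= ((2 * r).+1 ^ d)%:R * \sum_m a m ^+ 2.
  by apply: le_trans (sqr_sum_le _) _; rewrite card_ball.
have t0 : 0 < total_conductance w 0 by exact: total_conductance_gt0.
have d2 : 0 < (2 * d)%:R :> R by rewrite ltr0n muln_gt0.
apply: (@le_trans _ _ (total_conductance w 0 / (2 * d)%:R * (((2 * r).+1 ^ d)%:R * \sum_m a m ^+ 2))).
  by apply: ler_wpM2l h; rewrite divr_ge0// ltW.
rewrite mulrCA mulrC ler_pM2r// mulr_sumr; apply: ler_sum => m _.
have tm : 0 < total_conductance w (ball_point m) by exact: total_conductance_gt0.
have -> : transition_n w n (ball_point m) 0 =
   total_conductance w 0 / total_conductance w (ball_point m) * a m.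
  apply: (mulfI (lt0r_neq0 tm)); rewrite transition_n_sym /a.
  by field; rewrite gt_eqF.
rewrite -[transition_n w n 0 _]/(a m) [leRHS]mulrCA; rewrite -expr2; apply: ler_wpM2r; first exact: sqr_ge0.
by apply: ler_wpM2l; rewrite ?(ltW t0)// lef_pV2 ?posrE.
Qed.

(** The walk moves by one in each step, hence cannot leave this ball. *)
Lemma iter_averaging_ball_id n x : iter n averaging (ball_ind (supnorm x + n)) x = 1.
Proof.
have h m r y : (supnorm y + m <= r)%N -> iter m averaging (ball_ind r) y = 1.
  elim: m y => [|m IH] y; first by rewrite addn0 /= /ball_ind => ->.
  move=> yr /=; rewrite -[RHS](averaging_cst 1 y); apply: averaging_ext => u.
  by apply: IH; apply: leq_trans yr; rewrite addnS -addSn leq_add2r supnorm_step_le.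
exact: h.
Qed.

End walk.

(** * Exit times and effective resistance *)

Section green.
Context {R : realType} {d : nat}.
Variables (w : Zd d -> Zd d -> R) (k : Zd d -> R).
Hypotheses (d_gt0 : (0 < d)%N) (env_w : environment w).
Hypothesis k01 : forall x, k x = 0 \/ k x = 1.
Implicit Types (x y : Zd d) (n : nat).

Let k_ge0 x : 0 <= k x. Proof. by case: (k01 x) => ->. Qed.

(** Expected number of visits to y before time n, divided by the conductance at
y: this normalisation makes it symmetric. The truncation at time n avoids
infinite sums. *)
Definition green n y x : R :=
  (\sum_(j < n) killed_kernel w k j x y) / total_conductance w y.

Lemma green_ge0 n y x : 0 <= green n y x.
Proof.
apply: divr_ge0; last by rewrite ltW// total_conductance_gt0.
by apply: sumr_ge0 => j _; apply: iter_killed_ge0 => // z; exact: ler0n.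
Qed.

Lemma greenS n y x : green n.+1 y x =
  (x == y)%:R / total_conductance w y + averaging w (fun z => k z * green n y z) x.
Proof.
rewrite /green big_ord_recl mulrDl; congr (_ + _).
rewrite (@averaging_ext R d w _ (fun z => \sum_(j < n) (total_conductance w y)^-1 * (k z * killed_kernel w k j z y)) x); last first.
  move=> u; rewrite mulrA mulr_sumr mulr_suml.
  by apply: eq_bigr => j _; rewrite mulrC.
rewrite averaging_sum mulr_suml; apply: eq_bigr => j _; rewrite mulrC.
by [].
Qed.

Lemma green_mono n y x : green n y x <= green n.+1 y x.
Proof.
rewrite /green big_ord_recr ler_pM2r ?invr_gt0 ?total_conductance_gt0//= lerDl.
by apply: iter_killed_ge0 => // z; exact: ler0n.
Qed.

(** Maximum principle: the expected number of visits to y is largest when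
starting at y, as from elsewhere the walk first has to come to y. *)
Lemma green_max n y x : green n y x <= green n y y.
Proof.
elim: n x => [|n IH] x; first by rewrite /green !big_ord0.
have [->//|xy] := eqVneq x y.
apply: le_trans (green_mono n y y); rewrite greenS (negPf xy) mul0r add0r.
rewrite -[leRHS](averaging_cst d_gt0 env_w _ x); apply: averaging_le => // u.
by case: (k01 (x + step u)) => ->; rewrite ?mul0r ?mul1r ?green_ge0.
Qed.

Lemma green_sym n x y : k x = 1 -> k y = 1 -> green n y x = green n x y.
Proof.
move=> kx ky; rewrite /green.
have tx := total_conductance_gt0 d_gt0 env_w x.
have ty := total_conductance_gt0 d_gt0 env_w y.
rewrite !mulr_suml; apply: eq_bigr => j _.
have := killed_kernel_sym d_gt0 env_w k j x y; rewrite kx ky !mulr1 => h.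
apply: (mulfI (lt0r_neq0 tx)); rewrite mulrA h.
by field; rewrite !gt_eqF.
Qed.

(** As n tends to infinity, this increases to the effective resistance between x
and the killing set; the truncated value already satisfies the triangle
inequality along bonds. *)
Definition resistance n x : R := k x * green n x x.

(** Green's function is the potential of a current of total strength at most 1
leaving x. By the maximum principle the current through each bond at x is
nonnegative, so that none exceeds 1. *)
Lemma resistance_drop n x u : k x = 1 ->
  w x (x + step u) * (green n x x - k (x + step u) * green n x (x + step u)) <= 1.
Proof.
move=> kx; have tx := total_conductance_gt0 d_gt0 env_w x.
have term v : 0 <= w x (x + step v) * (green n x x - k (x + step v) * green n x (x + step v)).
  rewrite mulr_ge0 ?env_ge0// subr_ge0.
  by case: (k01 (x + step v)) => ->; rewrite ?mul0r ?mul1r ?green_ge0 ?green_max.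
apply: (@le_trans _ _ (\sum_v w x (x + step v) * (green n x x - k (x + step v) * green n x (x + step v)))).
  by rewrite (bigD1 u)//= lerDl sumr_ge0.
have := green_mono n x x; rewrite greenS eqxx -(ler_pM2l tx) mulrDr mul1r divff ?gt_eqF//.
rewrite /averaging mulr_sumr (eq_bigr (fun v => w x (x + step v) * (k (x + step v) * green n x (x + step v)))); last first.
  by move=> v _; rewrite /transition; field; rewrite gt_eqF.
move=> h; under eq_bigr do rewrite mulrBr.
by rewrite sumrB -mulr_suml -total_conductanceE// lerBlDr.
Qed.

(** The triangle inequality for the effective resistance along one bond. By
symmetry Green's function with pole x, taken at the neighbour, is also the one
with pole at the neighbour, taken at x, hence at most its maximum. *)
Lemma resistance_step n x u :
  `|resistance n x - resistance n (x + step u)| <= (w x (x + step u))^-1.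
Proof.
have aux y v : resistance n y - resistance n (y + step v) <= (w y (y + step v))^-1.
  have wy := env_step_gt0 env_w y v.
  rewrite /resistance; case: (k01 y) => ky; rewrite ky.
    rewrite mul0r sub0r lerNl; apply: (@le_trans _ _ 0); first by rewrite lerNl oppr0 invr_ge0 ltW.
    by rewrite mulr_ge0// green_ge0.
  rewrite mul1r -(ler_pM2l wy) divff ?gt_eqF//; apply: le_trans (resistance_drop n v ky).
  rewrite ler_pM2l// lerD2l lerN2; case: (k01 (y + step v)) => kv; rewrite kv ?mul0r// !mul1r.
  by rewrite (green_sym _ kv ky) green_max.
rewrite ler_norml; apply/andP; split; last exact: aux.
by rewrite lerNl opprB; have := aux (x + step u) (opposite u); rewrite addr_stepK (env_sym env_w x).
Qed.

Definition survival n : Zd d -> R := iter n (killed w k) (fun=> 1).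

Lemma survival_mono n x : survival n.+1 x <= survival n x.
Proof.
elim: n x => [|n IH] x.
  rewrite /survival /= /killed -[leRHS](averaging_cst d_gt0 env_w 1 x).
  by apply: averaging_le => // u; rewrite mulr1; case: (k01 (x + step u)) => ->.
by apply: averaging_le => // u; apply: ler_wpM2l => //; exact: IH.
Qed.

Lemma survival_antitone n m x : (n <= m)%N -> survival m x <= survival n x.
Proof.
move=> /subnKC <-; elim: (m - n)%N => [|j IH]; first by rewrite addn0.
by rewrite addnS; exact: le_trans (survival_mono _ _) IH.
Qed.

End green.

(** The expected time spent in the ball is a sum over its points of Green's
function times the conductance at the point; symmetry and the maximum principle
bound each value of Green's function by the resistance at 0. *)
Lemma survival_le_resistance {R : realType} {d : nat} (w : Zd d -> Zd d -> R) r n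
    (d_gt0 : (0 < d)%N) (env_w : environment w)
    (hw : forall x, total_conductance w x <= (2 * d)%:R) :
  n%:R * survival w (@ball_ind R d r) n 0 <=
  (2 * d)%:R * ((2 * r).+1 ^ d)%:R * resistance w (@ball_ind R d r) n 0.
Proof.
set k := ball_ind r.
have k01 x : k x = 0 \/ k x = 1 by rewrite /k /ball_ind; case: (_ <= _)%N; [right|left].
have k0 : k 0 = 1 by rewrite /k /ball_ind supnorm0.
have kb m : k (@ball_point d r m) = 1 by rewrite /k /ball_ind supnorm_ball_point.
have survE j : survival w k j 0 = \sum_m killed_kernel w k j 0 (@ball_point d r m).
  have E x : k x * survival w k j x = k x * iter j (killed w k) k x.
    elim: j x => [|j IH] x; first by rewrite /= mulr1; case: (k01 x) => ->; rewrite ?mulr0 ?mulr1.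
    by rewrite /= /killed; congr (_ * _); apply: averaging_ext => u; rewrite IH.
  have := E 0; rewrite k0 !mul1r => ->.
  rewrite {2}(_ : k = fun y => \sum_m 1 * dirac_fun (@ball_point d r m) y); last first.
    by apply/funext => y; rewrite /k ball_ind_sum.
  by rewrite iter_killed_sum; apply: eq_bigr => m _; rewrite mul1r.
have -> : resistance w k n 0 = green w k n 0 0 by rewrite /resistance k0 mul1r.
apply: (@le_trans _ _ (\sum_(j < n) survival w k j 0)).
  rewrite mulr_natl (_ : _ *+ n = \sum_(j < n) survival w k n 0); last first.
    by rewrite sumr_const card_ord.
  apply: ler_sum => j _.
  by apply: survival_antitone => //; exact/ltnW/ltn_ord.
under eq_bigr do rewrite survE.
rewrite exchange_big /=.
rewrite -mulrA mulrCA mulr_natl -card_ball -sumr_const; apply: ler_sum => m _.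
have tm := total_conductance_gt0 d_gt0 env_w (ball_point m).
have -> : \sum_(j < n) killed_kernel w k j 0 (ball_point m) =
   total_conductance w (ball_point m) * green w k n (ball_point m) 0.
  by rewrite /green mulrC divfK// gt_eqF.
rewrite green_sym//.
apply: (@le_trans _ _ ((2 * d)%:R * green w k n 0 (ball_point m))).
  by apply: ler_wpM2r => //; exact: green_ge0.
by apply: ler_wpM2l => //; exact: green_max.
Qed.

(** * Traps *)

Section traps.
Context {R : realType} {d : nat}.
Hypothesis d_gt0 : (0 < d)%N.
Implicit Types (w : Zd d -> Zd d -> R) (x y : Zd d) (u v : 'I_d * bool).

(** The trap attached to z lies outside of the ball whose boundary contains z,
so that it is independent of what the walk has seen when it first reaches z. *)
Definition outdir x : 'I_d * bool := sval (cid (outward_exists x d_gt0)).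

Lemma outdirP x : outward x (outdir x).
Proof. exact: svalP (cid (outward_exists x d_gt0)). Qed.

Definition trap1 x : Zd d := x + step (outdir x).
Definition trap2 x : Zd d := trap1 x + step (outdir x).

Lemma supnorm_trap1 x : supnorm (trap1 x) = (supnorm x).+1.
Proof. by case: (outward_step (outdirP x)). Qed.

Lemma supnorm_trap2 x : supnorm (trap2 x) = (supnorm x).+2.
Proof.
have [<- h] := outward_step (outdirP x).
by case: (outward_step h).
Qed.

(** The inner bond of the trap has conductance above a0, and all other bonds at
its two ends have conductance in ]l, h]. The lower bound l is needed on the bond
through which the trap is entered. *)
Definition trapped (a0 l h : R) w x : bool :=
  [forall v, if v == outdir x then a0 < w (trap1 x) (trap1 x + step v)
             else l < w (trap1 x) (trap1 x + step v) <= h] &&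
  [forall v, (v == opposite (outdir x)) ||
             (l < w (trap2 x) (trap2 x + step v) <= h)].

Variable w : Zd d -> Zd d -> R.
Hypothesis env_w : environment w.

(** The 2d - 1 weak bonds at x carry at most a proportion 2dh / a0 of its total
conductance. *)
Lemma transition_strong_bond a0 h x u : 0 < a0 -> 0 <= h -> a0 < w x (x + step u) ->
  (forall v, v != u -> w x (x + step v) <= h) ->
  1 - (2 * d)%:R * h / a0 <= transition w x (x + step u).
Proof.
move=> a00 h0 hu hv; set W := w x (x + step u) in hu *.
have W0 : 0 < W by exact: lt_trans hu.
have tW : total_conductance w x <= W + (2 * d)%:R * h.
  rewrite total_conductanceE// (bigD1 u)//= lerD2l.
  apply: (@le_trans _ _ (\sum_(v : 'I_d * bool) h)).
    rewrite [leRHS](bigD1 u)//= -[leLHS]add0r lerD//.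
    by apply: ler_sum => v vu; exact: hv.
  by rewrite sumr_const card_prod card_ord card_bool mulnC mulr_natl.
have t0 := total_conductance_gt0 d_gt0 env_w x.
have d0 : 0 <= (2 * d)%:R :> R by [].
have P0 : 0 <= (2 * d)%:R * h by exact: mulr_ge0.
apply: (@le_trans _ _ (W / (W + (2 * d)%:R * h))); last first.
  by rewrite /transition -/W ler_pM2l// lef_pV2 ?posrE// ltr_wpDr.
apply: (@le_trans _ _ (1 - (2 * d)%:R * h / W)).
  by rewrite lerD2l lerN2 ler_wpM2l// lef_pV2 ?posrE// ltW.
rewrite ler_pdivlMr; last by rewrite ltr_wpDr.
have : ((2 * d)%:R * h / W) * W = (2 * d)%:R * h by rewrite divfK// gt_eqF.
have : 0 <= (2 * d)%:R * h / W by rewrite divr_ge0// ltW.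
set P := (2 * d)%:R * h in P0 *; set q := P / W.
by move=> q0 qW; nra.
Qed.

(** The lower bound is the probability of crossing the inner bond back and forth
for n steps. *)
Lemma iter_averaging_trap a0 l h n r x (a00 : 0 < a0) (h0 : 0 <= h) :
  trapped a0 l h w x -> (supnorm x + 2 <= r)%N -> (2 * d)%:R * h / a0 <= 1 ->
  (1 - (2 * d)%:R * h / a0) ^+ n <= iter n (averaging w) (ball_ind r) (trap1 x) /\
  (1 - (2 * d)%:R * h / a0) ^+ n <= iter n (averaging w) (ball_ind r) (trap2 x).
Proof.
move=> /andP[/forallP t1 /forallP t2] xr h1; set e := _ / a0 in h1 *.
have e0 : 0 <= 1 - e by rewrite subr_ge0.
have P12 : 1 - e <= transition w (trap1 x) (trap2 x).
  apply: transition_strong_bond => //; first by have := t1 (outdir x); rewrite eqxx.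
  by move=> v vu; have := t1 v; rewrite (negPf vu) => /andP[].
have P21 : 1 - e <= transition w (trap2 x) (trap1 x).
  have E : trap1 x = trap2 x + step (opposite (outdir x)) by rewrite addr_stepK.
  rewrite [X in transition w _ X]E; apply: transition_strong_bond => //.
    by rewrite -E (env_sym env_w); have := t1 (outdir x); rewrite eqxx.
  by move=> v vu; have := t2 v; rewrite (negPf vu) => /andP[].
have one f y v : (forall y, 0 <= f y) -> transition w y (y + step v) * f (y + step v) <= averaging w f y.
  move=> f0; rewrite /averaging (bigD1 v)//= lerDl sumr_ge0// => v' _.
  by rewrite mulr_ge0// transition_ge0.
elim: n => [|n [IH1 IH2]].
  by rewrite expr0 /= /ball_ind supnorm_trap1 supnorm_trap2 !(leq_trans _ xr)// ?addn2 ?addn1// leqnSn.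
have f0 y : 0 <= iter n (averaging w) (ball_ind r) y.
  by apply: iter_averaging_ge0 => // z; exact: ler0n.
rewrite exprS /=; split.
  apply: le_trans (one _ (trap1 x) (outdir x) f0).
  by apply: ler_pM => //; rewrite exprn_ge0.
apply: le_trans (one _ (trap2 x) (opposite (outdir x)) f0).
by rewrite addr_stepK; apply: ler_pM => //; rewrite exprn_ge0.
Qed.

Lemma bernoulli_ineq (e : R) n : 0 <= e <= 1 -> 1 - n%:R * e <= (1 - e) ^+ n.
Proof.
move=> /andP[e0 e1]; elim: n => [|n IH]; first by rewrite mul0r subr0.
rewrite exprS; apply: (@le_trans _ _ ((1 - e) * (1 - n%:R * e))).
  rewrite -natr1; have : 0 <= n%:R :> R by []. nra.
by apply: ler_wpM2l => //; rewrite subr_ge0.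
Qed.

(** From the entrance the walk steps into the trap with probability at least
l / 2d, and then stays there with probability at least 1/2, as long as the time
is at most of the order of a0 / h. *)
Lemma trap_ball_ge a0 l h N n r x (a00 : 0 < a0) (h0 : 0 <= h) (l0 : 0 <= l) (l1 : l <= 1)
    (hw : forall x, total_conductance w x <= (2 * d)%:R) :
  trapped a0 l h w x -> (supnorm x + 2 <= r)%N ->
  N%:R * ((2 * d)%:R * h / a0) <= 1 / 2 -> (0 < N)%N -> (n <= N)%N ->
  l / (4 * d)%:R <= iter n (averaging w) (ball_ind r) x.
Proof.
move=> T xr Nh N0 nN.
set e := _ / a0 in Nh; have e0 : 0 <= e by rewrite divr_ge0 ?mulr_ge0// ltW.
have n1 : 1 <= N%:R :> R by rewrite ler1n.
have e1 : e <= 1 by nra.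
have f0 m y : 0 <= iter m (averaging w) (ball_ind r) y.
  by apply: iter_averaging_ge0 => // z; exact: ler0n.
have d1 : 1 <= d%:R :> R by rewrite ler1n.
case: n nN => [|n] nN.
  rewrite /= /ball_ind (leq_trans _ xr) ?leq_addr//= ler_pdivrMr ?mul1r; last by rewrite natrM; nra.
  by rewrite natrM; nra.
have [h1 _] := iter_averaging_trap n a00 h0 T xr e1.
have {}h1 : 1 / 2 <= iter n (averaging w) (ball_ind r) (trap1 x).
  apply: le_trans h1; apply: le_trans (bernoulli_ineq n _); last by rewrite e0.
  have : n%:R <= N%:R :> R by rewrite ler_nat ltnW.
  rewrite -/e; nra.
rewrite /= /averaging (bigD1 (outdir x))//=.
apply: (@le_trans _ _ (transition w x (trap1 x) * (1 / 2))); last first.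
  rewrite -[leLHS]addr0 lerD//; first by rewrite ler_wpM2l// transition_ge0.
  by apply: sumr_ge0 => v _; rewrite mulr_ge0// transition_ge0.
have tx := total_conductance_gt0 d_gt0 env_w x.
have lx : l <= w x (trap1 x).
  move: T => /andP[/forallP/(_ (opposite (outdir x))) + _].
  rewrite (_ : opposite _ == _ = false) => [/andP[+ _]|]; last first.
    by rewrite /opposite; case: (outdir x) => i [] /=; apply/eqP => -[].
  by rewrite addr_stepK (env_sym env_w) => /ltW.
have -> : l / (4 * d)%:R = l / (2 * d)%:R * (1 / 2).
  by rewrite !natrM; field; rewrite gt_eqF// ltr0n.
apply: ler_wpM2r => //; apply: ler_pM => //.
by rewrite lef_pV2 ?posrE ?ltr0n ?muln_gt0.
Qed.
End traps.

(** * Meeting a trap before leaving a ball *)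

Section decomposition.
Context {R : realType} {d : nat}.
Variable w : Zd d -> Zd d -> R.
Implicit Types (Z : pred (Zd d)) (h : Zd d -> R) (r k : nat) (x y : Zd d).

Definition reach_step Z r h (V : Zd d -> R) : Zd d -> R :=
  averaging w (fun y => if (r < supnorm y)%N then h y else if Z y then 0 else V y).

(** Expectation of h at the exit point from the ball of radius r, restricted to
exit within k steps and before any visit to Z. *)
Definition reach Z r h k : Zd d -> R := iter k (reach_step Z r h) (fun=> 0).

(** Probability of visiting Z within k steps and before leaving the ball. *)
Definition hit Z r k : Zd d -> R := iter k (fun V => averaging w
  (fun y => if (r < supnorm y)%N then 0 else if Z y then 1 else V y)) (fun=> 0).

Hypothesis d_gt0 : (0 < d)%N.
Hypothesis env_w : environment w.

(** After k steps the walk has met Z, or has left the ball before meeting Z, or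
is still in the ball. *)
Lemma hit_reach_survival Z r k x :
  1 <= hit Z r k x + reach Z r (fun=> 1) k x + survival w (ball_ind r) k x.
Proof.
elim: k x => [|k IH] x; first by rewrite /hit /reach /survival /= !add0r.
rewrite /hit /reach /survival /= /killed /reach_step -!averagingD.
rewrite -[leLHS](averaging_cst d_gt0 env_w 1 x); apply: averaging_le => // u.
rewrite /ball_ind ltnNge; case: leqP => xr /=.
  case: (Z _); last by rewrite mul1r; exact: IH.
  rewrite addr0 lerDl mul1r; apply: iter_killed_ge0 => // y; exact: ler0n.
by rewrite add0r lerDl mul0r.
Qed.

(** The strong Markov property at the first visit to Z. *)
Lemma hit_le_iter Z r k (A : Zd d -> R) c n N x : 0 <= c -> (forall y, 0 <= A y) ->
  (forall y m, Z y -> (supnorm y <= r)%N -> (m <= N)%N -> c <= iter m (averaging w) A y) ->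
  (k <= n <= N)%N -> c * hit Z r k x <= iter n (averaging w) A x.
Proof.
move=> c0 A0 AZ.
have A0' m y : 0 <= iter m (averaging w) A y by exact: iter_averaging_ge0.
elim: k n x => [|k IH] n x; first by rewrite /hit /= mulr0.
case: n => [//|n] /andP[kn nN]; rewrite /hit /= -averagingZ.
apply: averaging_le => // u; case: leqP => xr; last by rewrite mulr0.
case: (boolP (Z _)) => Zx; first by rewrite mulr1; apply: AZ => //; exact: ltnW.
by apply: IH; rewrite -ltnS kn ltnW.
Qed.

Lemma reach_ge0 Z r h k x : (forall y, 0 <= h y) -> 0 <= reach Z r h k x.
Proof.
move=> h0; elim: k x => [//|k IH] x; apply: averaging_ge0 => // y.
by case: ifP => // _; case: ifP.
Qed.

Lemma reach_le1 Z r h k x : (forall y, h y <= 1) -> reach Z r h k x <= 1.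
Proof.
move=> h1; elim: k x => [|k IH] x; first exact: ler01.
rewrite -[leRHS](averaging_cst d_gt0 env_w 1 x); apply: averaging_le => // u.
by case: ifP => // _; case: ifP.
Qed.

(** The walk moves by one in each step, so it leaves the ball of radius r
through the sphere of radius r + 1. *)
Lemma reach_sum Z r h k x : (supnorm x <= r)%N ->
  reach Z r h k x =
  \sum_m h (@ball_point d r.+1 m) * reach Z r (dirac_fun (@ball_point d r.+1 m)) k x.
Proof.
elim: k x => [|k IH] x xr; first by rewrite big1// => m _; rewrite mulr0.
rewrite /reach /= /reach_step -averaging_sum; apply: averaging_ext => u.
have xu : (supnorm (x + step u) <= r.+1)%N by exact: leq_trans (supnorm_step_le _ _) _.
case: leqP => xur; last first.
  rewrite -(sum_ball_point h xu); apply: eq_bigr => m _; rewrite mulrC.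
  by rewrite /dirac_fun.
by case: (Z _); [rewrite big1// => m _; rewrite mulr0 | exact: IH].
Qed.

(** To leave a larger ball untrapped, the walk has to leave the smaller one at
an untrapped point. *)
Lemma reach_nested Z r r' k x : (supnorm x <= r)%N -> (r < r')%N ->
  reach Z r' (fun=> 1) k x <= reach Z r (fun y => (~~ Z y)%:R) k x.
Proof.
move=> + rr'; elim: k x => [//|k IH] x xr; apply: averaging_le => // u.
have xu : (supnorm (x + step u) <= r')%N.
  by apply: leq_trans rr'; exact: leq_trans (supnorm_step_le _ _) _.
rewrite (ltnNge r') xu /=; case: leqP => xur.
  by case: (Z _) => //; exact: IH.
by case: (Z _) => //=; exact: reach_le1.
Qed.

Lemma reach_dirac_inside Z r y k x : (supnorm y <= r)%N ->
  reach Z r (dirac_fun y) k x = 0.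
Proof.
move=> yr; elim: k x => [//|k IH] x.
rewrite -[RHS](averaging_cst d_gt0 env_w 0 x); apply: averaging_ext => u.
case: leqP => xr; first by case: (Z _).
by rewrite /dirac_fun; case: eqP => // E; move: xr; rewrite E ltnNge yr.
Qed.

End decomposition.

(** * Open paths in a strip *)

(** The strip is cut into square cells of side W. The function f will be the
effective resistance, which changes by at most e along open bonds; H and V
single out the open bonds along rows and columns. *)
Section strip.
Context {R : realType}.
Variables (f : nat -> nat -> R) (H V : nat -> nat -> Prop) (e : R).
Hypothesis fH : forall c b, H c b -> `|f c b - f c.+1 b| <= e.
Hypothesis fV : forall c b, V c b -> `|f c b - f c b.+1| <= e.

Lemma dist_line (g : nat -> R) a b : (a <= b)%N ->
  (forall i, (a <= i < b)%N -> `|g i - g i.+1| <= e) -> `|g a - g b| <= (b - a)%:R * e.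
Proof.
move=> ab; elim: b ab => [|b IH] ab gi.
  by move: ab; rewrite leqn0 => /eqP ->; rewrite subrr normr0 mul0r.
move: ab; rewrite leq_eqVlt => /orP[/eqP ->|]; first by rewrite subrr normr0 subnn mul0r.
rewrite ltnS => ab; rewrite subSn// -natr1 mulrDl mul1r.
rewrite -(subrKA (g b)); apply: le_trans (ler_normD _ _) (lerD _ _).
  by apply: IH => // i /andP[ai ib]; apply: gi; rewrite ai ltnW.
by apply: gi; rewrite ab leqnn.
Qed.

Hypothesis e_ge0 : 0 <= e.
Variables (W m : nat).
Hypothesis col0 : forall b, (b < W)%N -> V 0 b.
Hypothesis rows : forall k, (k <= m)%N -> exists2 b, (b < W)%N &
  forall c, (k * W <= c < k.+2 * W)%N -> H c b.
Hypothesis cols : forall k, (k <= m)%N -> exists2 c, (k * W <= c < k.+1 * W)%N &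
  forall b, (b < W)%N -> V c b.

Let dist_row b c c' L : (forall i, (minn c c' <= i < maxn c c')%N -> H i b) ->
  (maxn c c' - minn c c' <= L)%N -> `|f c b - f c' b| <= L%:R * e.
Proof.
move=> Hb cL; apply: (@le_trans _ _ ((maxn c c' - minn c c')%:R * e)); last first.
  by apply: ler_wpM2r => //; rewrite ler_nat.
have h := @dist_line (fun c => f c b) (minn c c') (maxn c c').
have {}h := h (leq_trans (geq_minl _ _) (leq_maxl _ _)) (fun i hi => fH (Hb i hi)).
apply: le_trans h; rewrite /minn /maxn; case: ifP => // _; by rewrite distrC.
Qed.

Let dist_col c b b' : (forall b, (b < W)%N -> V c b) -> (b < W)%N -> (b' < W)%N ->
  `|f c b - f c b'| <= W%:R * e.
Proof.
move=> Vc; wlog bb : b b' / (b <= b')%N.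
  move=> h bW b'W; have [|/ltnW] := leqP b b'; first by move=> /h; apply.
  by move=> /h h'; rewrite distrC; exact: h'.
move=> bW b'W; apply: le_trans (dist_line (g := f c) bb _) _.
  by move=> i /andP[_ ib]; apply/fV/Vc; exact: ltn_trans ib _.
by apply: ler_wpM2r => //; rewrite ler_nat (leq_trans (leq_subr _ _))// ltnW.
Qed.

(** The row which is open throughout cells k and k + 1, and the one which is open
throughout cells k + 1 and k + 2, are connected by an open column of cell
k + 1. *)
Lemma strip_dist k : (0 < W)%N -> (k <= m)%N -> exists b, [/\ (b < W)%N,
    forall c, (k * W <= c < k.+2 * W)%N -> H c b &
    `|f 0 0 - f (k * W)%N b| <= (W + k * (4 * W))%:R * e].
Proof.
move=> W0; elim: k => [|k IH] km.
  have [b bW Hb] := rows km; exists b; split => //.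
  by rewrite mul0n addn0; exact: dist_col.
have [b [bW Hb fb]] := IH (ltnW km).
have [b' b'W Hb'] := rows km; have [c cW Vc] := cols km.
exists b'; split => //.
have h1 : `|f (k * W)%N b - f c b| <= (2 * W)%:R * e.
  apply: dist_row => [i hi|]; last by move: cW; rewrite !mulSn; lia.
  by apply: Hb; move: cW hi; rewrite !mulSn; lia.
have h2 : `|f c b - f c b'| <= W%:R * e by exact: dist_col.
have h3 : `|f c b' - f (k.+1 * W)%N b'| <= W%:R * e.
  apply: dist_row => [i hi|]; last by move: cW; rewrite !mulSn; lia.
  by apply: Hb'; move: cW hi; rewrite !mulSn; lia.
have -> : (W + k.+1 * (4 * W))%:R * e =
   (W + k * (4 * W))%:R * e + (2 * W)%:R * e + W%:R * e + W%:R * e.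
  by rewrite -!mulrDl -!natrD; congr (_%:R * e); lia.
rewrite -(subrKA (f c b')); apply: le_trans (ler_normD _ _) (lerD _ h3).
rewrite -(subrKA (f c b)); apply: le_trans (ler_normD _ _) (lerD _ h2).
rewrite -(subrKA (f (k * W)%N b)); exact: le_trans (ler_normD _ _) (lerD fb h1).
Qed.
End strip.

Section strip_lattice.
Context {R : realType} {d : nat}.
Variables (i0 i1 : 'I_d).
Hypothesis i01 : i0 != i1.

Definition plane_point (c b : nat) : Zd d :=
  \row_i (if i == i0 then c%:Z else if i == i1 then b%:Z else 0).

Lemma plane_point0 : plane_point 0 0 = 0.
Proof. by apply/rowP => i; rewrite !mxE; case: eqP => // _; case: eqP. Qed.

Lemma plane_pointSl c b : plane_point c.+1 b = plane_point c b + step (i0, true).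
Proof.
apply/rowP => i; rewrite /step !mxE /=; case: (eqVneq i i0) => _ /=; first by lia.
by rewrite addr0.
Qed.

Lemma plane_pointSr c b : plane_point c b.+1 = plane_point c b + step (i1, true).
Proof.
apply/rowP => i; rewrite /step !mxE /=; case: (eqVneq i i0) => [->|ii0] /=.
  by rewrite (negPf i01) addr0.
by case: eqP => _ /=; [lia|rewrite addr0].
Qed.

Lemma supnorm_plane_point c b : (c <= supnorm (plane_point c b))%N.
Proof.
have := iffRL (supnorm_leP (plane_point c b) _) (leqnn _) i0.
by rewrite mxE eqxx.
Qed.

Definition row_bond c b : bond d := (plane_point c b, i0).
Definition column_bond c b : bond d := (plane_point c b, i1).

Lemma row_bond_end c b : bond_end (row_bond c b) = plane_point c.+1 b.
Proof. by rewrite plane_pointSl. Qed.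

Lemma column_bond_end c b : bond_end (column_bond c b) = plane_point c b.+1.
Proof. by rewrite plane_pointSr. Qed.

(** The strip contains a path of at most W + 4Wm open bonds from 0 to the outside
of the ball, where the resistance vanishes. *)
Lemma resistance_strip (w : Zd d -> Zd d -> R) (a : R) W m r n :
  environment w -> 0 < a -> (0 < W)%N -> (r < m * W)%N ->
  (forall b, (b < W)%N -> a < w (plane_point 0 b) (plane_point 0 b.+1)) ->
  (forall k, (k <= m)%N -> exists2 b, (b < W)%N &
    forall c, (k * W <= c < k.+2 * W)%N -> a < w (plane_point c b) (plane_point c.+1 b)) ->
  (forall k, (k <= m)%N -> exists2 c, (k * W <= c < k.+1 * W)%N &
    forall b, (b < W)%N -> a < w (plane_point c b) (plane_point c b.+1)) ->
  resistance w (ball_ind r) n 0 <= (W + m * (4 * W))%:R / a.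
Proof.
move=> env_w a0 W0 rm hc0 hr hc.
have d0 : (0 < d)%N by case: (i0) => j; case: (d).
have k01 (x : Zd d) : ball_ind r x = 0 :> R \/ ball_ind r x = 1 :> R.
  by rewrite /ball_ind; case: (_ <= _)%N; [right|left].
pose f c b := resistance w (ball_ind r) n (plane_point c b).
have fH c b : a < w (plane_point c b) (plane_point c.+1 b) -> `|f c b - f c.+1 b| <= a^-1.
  move=> h; rewrite /f plane_pointSl.
  apply: le_trans (resistance_step d0 env_w k01 n _ _) _.
  by rewrite -plane_pointSl lef_pV2 ?posrE ?(lt_trans a0 h)// ltW.
have fV c b : a < w (plane_point c b) (plane_point c b.+1) -> `|f c b - f c b.+1| <= a^-1.
  move=> h; rewrite /f plane_pointSr.
  apply: le_trans (resistance_step d0 env_w k01 n _ _) _.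
  by rewrite -plane_pointSr lef_pV2 ?posrE ?(lt_trans a0 h)// ltW.
have a'0 : 0 <= a^-1 by rewrite invr_ge0 ltW.
have [b [_ _]] := strip_dist fH fV a'0 hc0 hr hc W0 (leqnn m).
have -> : f (m * W)%N b = 0.
  by rewrite /f /resistance {1}/ball_ind leqNgt (leq_trans rm (supnorm_plane_point _ _)) mul0r.
by rewrite subr0 /f plane_point0; apply: le_trans; rewrite ler_norm.
Qed.

End strip_lattice.

(** * Return probabilities in a fixed environment *)

Section quenched.
Context {R : realType} {d : nat}.
Hypothesis d_gt0 : (0 < d)%N.

(** Only every third sphere is used: the trap of a point at distance s has its
bonds within distance s + 3, so that it does not share any bond with the traps
of the next sphere, which lie outside of it. *)
Definition trap_sites (a0 l h : R) (w : Zd d -> Zd d -> R) : pred (Zd d) :=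
  fun y => (3 %| supnorm y)%N && trapped d_gt0 a0 l h w y.

(** The walk is still in the ball of radius r with probability at most 1/4, and
has left it without meeting a trap with probability at most 1/4; so it has met a
trap with probability at least 1/2. *)
Lemma return_ge_of_traps (i0 i1 : 'I_d) (w : Zd d -> Zd d -> R) (a0 l h a : R)
    (W m r N n : nat) :
  i0 != i1 -> environment w -> (forall x, total_conductance w x <= (2 * d)%:R) ->
  0 < a0 -> 0 <= h -> 0 <= l <= 1 -> 0 < a -> (0 < W)%N -> (r < m * W)%N -> (0 < N)%N ->
  (forall b, (b < W)%N -> a < w (plane_point i0 i1 0 b) (plane_point i0 i1 0 b.+1)) ->
  (forall k, (k <= m)%N -> exists2 b, (b < W)%N & forall c, (k * W <= c < k.+2 * W)%N ->
     a < w (plane_point i0 i1 c b) (plane_point i0 i1 c.+1 b)) ->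
  (forall k, (k <= m)%N -> exists2 c, (k * W <= c < k.+1 * W)%N & forall b, (b < W)%N ->
     a < w (plane_point i0 i1 c b) (plane_point i0 i1 c b.+1)) ->
  (8 * d)%:R * ((2 * r).+1 ^ d)%:R * ((W + m * (4 * W))%:R / a) <= N%:R ->
  (4 * N)%:R * ((2 * d)%:R * h / a0) <= 1 / 2 ->
  reach w (trap_sites a0 l h w) r (fun=> 1) N 0 <= 1 / 4 ->
  (N <= n <= 4 * N)%N ->
  total_conductance w 0 / (2 * d)%:R * (l / (8 * d)%:R) ^+ 2 /
    ((2 * r.+2).+1 ^ d)%:R <= transition_n w (2 * n) 0 0.
Proof.
move=> i01 env_w hw a00 h0 /andP[l0 l1] apos W0 rm N0 hc0 hr hc hN hh hreach hn.
set Z := trap_sites _ _ _ _ in hreach.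
have d1 : 1 <= d%:R :> R by rewrite ler1n.
have N1 : 1 <= N%:R :> R by rewrite ler1n.
have surv : survival w (ball_ind r) N 0 <= 1 / 4.
  have h1 := survival_le_resistance r N d_gt0 env_w hw.
  have h2 := @resistance_strip R d i0 i1 i01 w a W m r N env_w apos W0 rm hc0 hr hc.
  have h3 : N%:R * survival w (ball_ind r) N 0 <= N%:R / 4.
    apply: (le_trans h1).
    apply: (@le_trans _ _ ((2 * d)%:R * ((2 * r).+1 ^ d)%:R * ((W + m * (4 * W))%:R / a))).
      by apply: ler_wpM2l h2; rewrite mulr_ge0.
    rewrite ler_pdivlMr//; apply: le_trans hN.
    move: (((2 * r).+1 ^ d)%:R) (_ / a) => p q.
    have -> : (8 * d = 2 * d * 4)%N by rewrite mulnAC.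
    rewrite natrM.
    by rewrite le_eqVlt; apply/orP; left; apply/eqP; ring.
  by rewrite -(@ler_pM2l _ N%:R) ?ltr0n// mul1r.
have hhit : 1 / 2 <= hit w Z r N 0.
  by have := hit_reach_survival d_gt0 env_w Z r N 0; lra.
have stay : l / (4 * d)%:R * hit w Z r N 0 <= iter n (averaging w) (ball_ind r.+2) 0.
  apply: (@hit_le_iter _ _ _ d_gt0 env_w Z r N _ _ n (4 * N)) => //.
  - by rewrite divr_ge0.
  - move=> y j /andP[_ Ty] yr jN.
    apply: (trap_ball_ge env_w a00 h0 l0 l1 hw Ty _ hh) => //; first by rewrite addn2 !ltnS.
    by rewrite muln_gt0.
apply: le_trans (return_ge_sqr_ball d_gt0 env_w hw n r.+2).
apply: ler_wpM2r; first by rewrite invr_ge0.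
apply: ler_wpM2l; first by rewrite divr_ge0// ltW// total_conductance_gt0.
have q0 : 0 <= l / (8 * d)%:R by rewrite divr_ge0.
rewrite ler_pXn2r ?nnegrE//; last first.
  by apply: iter_averaging_ge0 => // y; exact: ler0n.
apply: le_trans stay.
have -> : l / (8 * d)%:R = l / (4 * d)%:R * (1 / 2).
  by rewrite !natrM; field; rewrite gt_eqF// ltr0n.
by apply: ler_wpM2l => //; rewrite divr_ge0.
Qed.

Lemma return_ge_trivial (w : Zd d -> Zd d -> R) n :
  environment w -> (forall x, total_conductance w x <= (2 * d)%:R) ->
  total_conductance w 0 / (2 * d)%:R / ((2 * n).+1 ^ d)%:R <= transition_n w (2 * n) 0 0.
Proof.
move=> env_w hw; apply: le_trans (return_ge_sqr_ball d_gt0 env_w hw n n).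
have := iter_averaging_ball_id d_gt0 env_w n 0.
by rewrite supnorm0 add0n => ->; rewrite expr1n mulr1.
Qed.
End quenched.

(** * Independence *)

Section independence.
Context {R : realType} {disp : measure_display} {T : measurableType disp}.
Variables (Q : probability T R) (I : choiceType) (X : I -> T -> R).
Hypothesis mX : forall i, measurable_fun setT (X i).
Hypothesis indX : mutually_independent Q X.
Local Open Scope ereal_scope.

Definition rectangle (J : {fset I}) (B : I -> set R) : set T :=
  \bigcap_(i in [set` J]) (X i @^-1` B i).

Lemma measurable_rectangle J B : (forall i, measurable (B i)) -> measurable (rectangle J B).
Proof.
move=> mB; apply: fin_bigcap_measurable => // i _.
by rewrite -[X in measurable X]setTI; exact: mX.
Qed.

(** These sets form a pi-system which generates the sigma-algebra of the
variables with index in D. *)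
Definition cylinders (D : set I) : set (set T) :=
  [set A | exists J : {fset I}, [set` J] `<=` D /\
     exists2 B : I -> set R, (forall i, measurable (B i)) & A = rectangle J B].

Lemma cylinders_measurable D : cylinders D `<=` measurable.
Proof. by move=> A [J [_ [B mB ->]]]; exact: measurable_rectangle. Qed.

Lemma cylindersT D : cylinders D setT.
Proof.
exists fset0; split=> [i|]; first by rewrite /= in_fset0.
exists (fun=> setT) => //; apply/seteqP; split => // t _ i /=.
Qed.

Lemma cylindersI D : setI_closed (cylinders D).
Proof.
move=> _ _ [J [JD [B mB ->]]] [J' [JD' [B' mB' ->]]].
exists (J `|` J')%fset; split.
  by move=> i /=; rewrite in_fsetU => /orP[]; [exact: JD|exact: JD'].
exists (fun i => (if i \in J then B i else setT) `&` (if i \in J' then B' i else setT)).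
  by move=> i; apply: measurableI; case: ifP.
apply/seteqP; split => t.
- move=> [h h'] i /= _; split; first by case: ifP => // iJ; exact: h.
  by case: ifP => // iJ; exact: h'.
- move=> h; split=> i /= iJ; have := h i; rewrite /= in_fsetU iJ ?orbT => /(_ isT)[] //.
Qed.

Definition sub_sigma D := g_sigma_algebraType (cylinders D).

Lemma measurable_sub_sigma D i : D i -> measurable_fun [set: sub_sigma D] (X i).
Proof.
move=> Di _ Y mY; rewrite setTI; apply: sub_sigma_algebra.
exists [fset i]%fset; split => [j|]; first by rewrite /= in_fset1 => /eqP ->.
exists (fun=> Y) => //; apply/seteqP; split => t /=.
  by move=> h j /=; rewrite in_fset1 => /eqP ->.
by move=> /(_ i); apply; rewrite /= in_fset1.
Qed.

Lemma measurable_id_sub_sigma D : measurable_fun [set: T] (id : T -> sub_sigma D).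
Proof.
move=> _ Y mY; rewrite setTI.
apply: (smallest_sub (@sigma_algebra_measurable _ T) (@cylinders_measurable D) mY).
Qed.

Lemma measurable_of_sub_sigma D d' (T' : measurableType d') (f : T -> T') :
  measurable_fun [set: sub_sigma D] (f : sub_sigma D -> T') -> measurable_fun [set: T] f.
Proof.
move=> mf _ Y mY; have := mf measurableT Y mY; rewrite !setTI => h.
exact: (smallest_sub (@sigma_algebra_measurable _ T) (@cylinders_measurable D) h).
Qed.

Variables (D : set I) (J0 : {fset I}) (B0 : I -> set R).
Hypothesis mB0 : forall i, measurable (B0 i).
Hypothesis J0D : forall i, i \in J0 -> ~ D i.

Let E := rectangle J0 B0.
Let mE : measurable E. Proof. exact: measurable_rectangle. Qed.

Lemma rectangle_indep A : cylinders D A -> Q (A `&` E) = Q E * Q A.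
Proof.
move=> [J [JD [B mB ->]]].
have dis i : i \in J -> i \notin J0.
  by move=> iJ; apply/negP => /J0D; apply; exact: JD.
pose B1 i := if i \in J then B i else B0 i.
have mB1 i : measurable (B1 i) by rewrite /B1; case: ifP.
have -> : rectangle J B `&` E = rectangle (J0 `|` J)%fset B1.
  apply/seteqP; split => t.
  - move=> [h h'] i /=; rewrite in_fsetU /B1; case: ifP => iJ; first by move=> _; exact: h.
    by rewrite orbF => iJ0; exact: h'.
  - move=> h; split => i /= iJ; have := h i; rewrite /= in_fsetU iJ ?orbT => /(_ isT).
      by rewrite /B1 iJ.
    by rewrite /B1; case: ifP => // /dis; rewrite iJ.
rewrite /E /rectangle !indX//.
have P : perm_eq (enum_fset (J0 `|` J)%fset) (enum_fset J0 ++ enum_fset J).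
  apply: uniq_perm; first exact: fset_uniq.
    rewrite cat_uniq !fset_uniq /= andbT; apply/hasPn => i /= iJ; exact: dis.
  by move=> i; rewrite mem_cat in_fsetU.
rewrite (perm_big _ P) big_cat /=; congr (_ * _); rewrite !big_seq; apply: eq_bigr => i iJ.
  by rewrite /B1; case: ifP => // /dis; rewrite iJ.
by rewrite /B1 iJ.
Qed.

(** The measures which send A to Q (A & E) and to Q E * Q A agree on cylinders,
hence on the sigma-algebra which they generate, hence on integrals of functions
measurable for it. *)
Lemma integral_indep (f : T -> R) : measurable_fun [set: sub_sigma D] (f : sub_sigma D -> R) ->
  (forall t, (0 <= f t)%R) ->
  \int[Q]_(t in E) (f t)%:E = Q E * \int[Q]_t (f t)%:E.
Proof.
move=> mf f0; have mfT := measurable_of_sub_sigma mf.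
have QE0 : (0 <= fine (Q E))%R by rewrite fine_ge0// measure_ge0.
pose k : {nonneg R} := NngNum QE0.
have kE : k%:num%:E = Q E by rewrite /= fineK// fin_num_measure.
pose m1 : {measure set T -> \bar R} := mrestr Q mE.
pose m2 : {measure set T -> \bar R} := mscale k Q.
have m12 : forall A, <<s cylinders D >> A -> m1 A = m2 A.
  apply: (@g_sigma_algebra_measure_unique _ _ _ _ (@cylinders_measurable D) (fun=> setT)) => //.
  - by move=> i; exact: cylindersT.
  - by apply/seteqP; split => // t _; exists 0%N.
  - exact: cylindersI.
  - move=> A cA; rewrite /m1 /m2 /= /mrestr /mscale /= (rectangle_indep cA).
    by rewrite fineK// fin_num_measure.
  - by move=> i; rewrite /m1 /= /mrestr setTI (le_lt_trans (probability_le1 _ _))// ltry.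
have mid := @measurable_id_sub_sigma D.
have mEf : @measurable_fun _ _ (sub_sigma D) (\bar R) setT (fun t => (f t)%:E).
  exact/measurable_EFinP.
have push (m : {measure set T -> \bar R}) : \int[m]_t (f t)%:E =
    \int[pushforward m (id : T -> sub_sigma D)]_t (f t)%:E.
  by rewrite (ge0_integral_pushforward mid)// => t _; rewrite lee_fin.
have E12 : \int[m1]_t (f t)%:E = \int[m2]_t (f t)%:E.
  rewrite !push; apply: eq_measure_integral => A mA _; exact: m12.
have E2 : \int[m2]_t (f t)%:E = Q E * \int[Q]_t (f t)%:E.
  rewrite ge0_integral_mscale ?kE//; first exact/measurable_EFinP.
  by move=> t _; rewrite lee_fin.
rewrite -E2 -E12 -[in RHS](setvU E) ge0_integral_setU//; last 4 first.
- exact: measurableC.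
- by rewrite setvU; exact/measurable_EFinP.
- by move=> t _; rewrite lee_fin.
- by rewrite disj_set2E setICl eqxx.
rewrite (_ : \int[m1]_(t in ~` E) _ = 0) ?add0e; last first.
  rewrite -(integral_measure_zero (~` E) (fun t => (f t)%:E)).
  apply: eq_measure_integral => A mA AE /=; rewrite /mrestr (_ : A `&` E = set0) ?measure0//.
  by apply/seteqP; split => // t [/AE].
by apply: eq_measure_integral => A mA AE; rewrite /m1 /= /mrestr setIidl.
Qed.

End independence.

(** * Measurability of the walk *)

Section trap_rectangle.
Context {R : realType} {d : nat}.
Hypothesis d_gt0 : (0 < d)%N.
Implicit Types (x z : Zd d) (b : bond d).

Definition trap_bonds z : {fset bond d} :=
  [fset b in [seq bond_at (trap1 d_gt0 z) v | v <- enum {: 'I_d * bool}] ++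
             [seq bond_at (trap2 d_gt0 z) v | v <- enum {: 'I_d * bool}]]%fset.

Definition trap_range (a0 l h : R) z b : set R :=
  if b == bond_at (trap1 d_gt0 z) (outdir d_gt0 z)
  then [set` `]a0, +oo[] else [set` `]l, h]].

Lemma env_bond_at (w : Zd d -> Zd d -> R) x u : environment w ->
  w (bond_at x u).1 (bond_end (bond_at x u)) = w x (x + step u).
Proof.
by move=> env; case: (bond_at_ends x u) => -[-> ->] //; rewrite (env_sym env).
Qed.

Lemma trap_bondsP z b : reflect
  (exists v, b = bond_at (trap1 d_gt0 z) v \/ b = bond_at (trap2 d_gt0 z) v)
  (b \in trap_bonds z).
Proof.
rewrite in_fset /= mem_cat; apply: (iffP orP) => [[/mapP[v _ ->]|/mapP[v _ ->]]|[v [->|->]]].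
- by exists v; left.
- by exists v; right.
- by left; apply/mapP; exists v => //; rewrite mem_enum.
- by right; apply/mapP; exists v => //; rewrite mem_enum.
Qed.

Lemma card_trap_bonds z : (#|` trap_bonds z| <= 4 * d)%N.
Proof.
apply: (@leq_trans (size ([seq bond_at (trap1 d_gt0 z) v | v <- enum {: 'I_d * bool}] ++
             [seq bond_at (trap2 d_gt0 z) v | v <- enum {: 'I_d * bool}]))).
  by rewrite card_imfset//= size_undup.
by rewrite size_cat !size_map -!enumT -!cardT card_prod card_ord card_bool; lia.
Qed.

(** The inner bond belongs to both ends of the trap, seen in opposite
directions. *)
Lemma trappedE (a0 l h : R) (w : Zd d -> Zd d -> R) z : environment w ->
  trapped d_gt0 a0 l h w z <->
  forall b, b \in trap_bonds z -> trap_range a0 l h z b (w b.1 (bond_end b)).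
Proof.
move=> env; set u := outdir d_gt0 z.
have E12 : bond_at (trap2 d_gt0 z) (opposite u) = bond_at (trap1 d_gt0 z) u.
  exact: bond_at_opposite.
split.
- move=> /andP[/forallP t1 /forallP t2] b /trap_bondsP[v [->|->]].
  + rewrite env_bond_at// /trap_range (inj_eq (@bond_at_inj _ _)).
    have := t1 v; case: ifP => _ /=; rewrite in_itv /= ?andbT//.
  + rewrite env_bond_at// /trap_range -/u -E12 (inj_eq (@bond_at_inj _ _)).
    have := t2 v; case: eqP => [-> _ /=|_ /=]; last by rewrite in_itv.
    rewrite in_itv /= andbT addr_stepK (env_sym env).
    by have := t1 u; rewrite eqxx.
- move=> H; apply/andP; split; apply/forallP => v.
  + have /H : bond_at (trap1 d_gt0 z) v \in trap_bonds z by apply/trap_bondsP; exists v; left.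
    rewrite env_bond_at// /trap_range (inj_eq (@bond_at_inj _ _)).
    by case: ifP => _ /=; rewrite in_itv /= ?andbT.
  + have /H : bond_at (trap2 d_gt0 z) v \in trap_bonds z by apply/trap_bondsP; exists v; right.
    rewrite env_bond_at// /trap_range -/u -E12 (inj_eq (@bond_at_inj _ _)).
    by case: eqP => //= _; rewrite in_itv.
Qed.

End trap_rectangle.

(** The sigma-algebra on T is arbitrary here: it will be the one generated by the
bonds in a ball, as well as the full one. *)
Section reach_measurable.
Context {R : realType} {d : nat} {disp : measure_display} {T : measurableType disp}.
Hypothesis d_gt0 : (0 < d)%N.
Variables (om : T -> Zd d -> Zd d -> R) (a0 l h : R) (r : nat).
Hypothesis env : forall t, environment (om t).
Hypothesis mom : forall x u, (supnorm x <= r)%N ->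
  measurable_fun setT (fun t => om t x (x + step u)).

Lemma measurable_transition x u : (supnorm x <= r)%N ->
  measurable_fun setT (fun t => transition (om t) x (x + step u)).
Proof.
move=> xr; apply: measurable_funM; first exact: mom.
rewrite (_ : (fun t => _) = (fun t => (\sum_v om t x (x + step v)) `^ (-1))); last first.
  apply/funext => t; rewrite total_conductanceE// powR_inv1// sumr_ge0// => v _.
  exact: env_ge0.
apply: (@measurableT_comp _ _ _ _ _ _ (@powR R ^~ (-1)) _ (fun t => \sum_v om t x (x + step v))).
  exact: measurable_powR.
by apply: measurable_sum => v; exact: mom.
Qed.

Lemma measurable_trapped z : (supnorm z + 2 <= r)%N ->
  measurable_fun setT (fun t => trapped d_gt0 a0 l h (om t) z).
Proof.
move=> zr; apply: (measurable_fun_bool true); rewrite setTI.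
rewrite (_ : _ @^-1` _ = \bigcap_(b in [set` trap_bonds d_gt0 z])
   ((fun t => om t b.1 (bond_end b)) @^-1` trap_range d_gt0 a0 l h z b)); last first.
  apply/seteqP; split => t /= => [/(trappedE d_gt0 a0 l h z (env t)) //|H].
  exact/(trappedE d_gt0 a0 l h z (env t)).
apply: fin_bigcap_measurable => // b /= /trap_bondsP[v bv].
have mb : measurable_fun setT (fun t => om t b.1 (bond_end b)).
  case: bv => ->.
  - rewrite (_ : (fun t => _) = fun t => om t (trap1 d_gt0 z) (trap1 d_gt0 z + step v)).
      by apply: mom; rewrite supnorm_trap1; lia.
    by apply/funext => t; rewrite env_bond_at.
  - rewrite (_ : (fun t => _) = fun t => om t (trap2 d_gt0 z) (trap2 d_gt0 z + step v)).
      by apply: mom; rewrite supnorm_trap2; lia.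
    by apply/funext => t; rewrite env_bond_at.
rewrite -[X in measurable X]setTI; apply: mb => //.
by rewrite /trap_range; case: ifP => _; exact: measurable_itv.
Qed.

(** The traps with entrance in the ball are then determined by bonds which have
an end in the ball. *)
Hypothesis r_mod3 : (r %% 3 = 2)%N.

Lemma measurable_reach f k x : (supnorm x <= r)%N ->
  measurable_fun setT (fun t => reach (om t) (trap_sites d_gt0 a0 l h (om t)) r f k x).
Proof.
elim: k x => [|k IH] x xr; first exact: measurable_cst.
apply: measurable_sum => u; apply: measurable_funM; first exact: measurable_transition.
case: leqP => xur; last exact: measurable_cst.
apply: measurable_fun_ifT; [|exact: measurable_cst|exact: IH].
rewrite /trap_sites; case: (boolP (3 %| _)%N) => [/dvdnP[j xuj]|_]; last exact: measurable_cst.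
by apply: measurable_trapped; move: xur r_mod3; rewrite xuj; lia.
Qed.

End reach_measurable.

(** * The averaged probability of meeting no trap *)

Section annealed.
Context {R : realType} {d : nat} {disp : measure_display} {T : measurableType disp}.
Hypothesis d_gt0 : (0 < d)%N.
Variables (Q : probability T R) (omega : T -> Zd d -> Zd d -> R).
Hypothesis iid : iid_conductances Q omega.
Variables (a0 l h q : R).
Local Open Scope ereal_scope.

Let X b t := conductance omega b t.
Let env t : environment (omega t). Proof. by case: iid. Qed.
Let mX b : measurable_fun setT (X b). Proof. by case: iid. Qed.
Let indX : mutually_independent Q X. Proof. by case: iid. Qed.
Let Z t := trap_sites d_gt0 a0 l h (omega t).

Lemma omega_conductance x u t : omega t x (x + step u) = X (bond_at x u) t.
Proof. by rewrite /X /conductance env_bond_at. Qed.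

Lemma trapped_rectangle z : [set t | trapped d_gt0 a0 l h (omega t) z] =
  rectangle X (trap_bonds d_gt0 z) (trap_range d_gt0 a0 l h z).
Proof.
apply/seteqP; split => t /= => [/(trappedE d_gt0 a0 l h z (env t)) //|H].
exact/(trappedE d_gt0 a0 l h z (env t)).
Qed.

Lemma measurable_trap_range z b : measurable (trap_range d_gt0 a0 l h z b).
Proof. by rewrite /trap_range; case: ifP => _; exact: measurable_itv. Qed.

Hypothesis q01 : (0 <= q <= 1)%R.
Hypothesis trap_prob : forall z, q%:E <= Q [set t | trapped d_gt0 a0 l h (omega t) z].

(** These bonds determine the walk up to its exit from the ball of radius r. *)
Let D r : set (bond d) :=
  [set b | (supnorm b.1 <= r.+1)%N /\ (supnorm (bond_end b) <= r.+1)%N].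

Let measurable_reach_sub r f k : (r %% 3 = 2)%N ->
  measurable_fun [set: sub_sigma X (D r)]
    ((fun t => reach (omega t) (Z t) r f k 0) : sub_sigma X (D r) -> R).
Proof.
move=> r3; apply: (@measurable_reach R d _ (sub_sigma X (D r)) d_gt0 omega a0 l h r) => //.
- move=> x u xr; rewrite (_ : (fun t => _) = X (bond_at x u)); last first.
    by apply/funext => t; exact: omega_conductance.
  apply: measurable_sub_sigma => //.
  have xu : (supnorm (x + step u)%R <= r.+1)%N.
    by apply: leq_trans (supnorm_step_le _ _) _.
  have xr' : (supnorm x <= r.+1)%N by exact: leq_trans xr _.
  by case: (bond_at_ends x u) => -[E1 E2]; split; rewrite ?E1 ?E2.
- by rewrite supnorm0.
Qed.

Let measurable_reachT r f k : (r %% 3 = 2)%N ->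
  measurable_fun [set: T] (fun t => reach (omega t) (Z t) r f k 0).
Proof. by move=> r3; apply: (measurable_of_sub_sigma mX (@measurable_reach_sub r f k r3)). Qed.

Let integral_reach_fin r (f : Zd d -> R) k : (r %% 3 = 2)%N -> (forall y, 0 <= f y <= 1)%R ->
  \int[Q]_t (reach (omega t) (Z t) r f k 0)%:E \is a fin_num.
Proof.
move=> r3 f01; have f0 y : (0 <= f y)%R by case/andP: (f01 y).
rewrite ge0_fin_numE; last by apply: integral_ge0 => t _; rewrite lee_fin reach_ge0.
apply: (@le_lt_trans _ _ (\int[Q]_t (cst 1 t))).
  apply: ge0_le_integral => //.
  - by move=> t _; rewrite lee_fin reach_ge0.
  - exact/measurable_EFinP/measurable_reachT.
  - by move=> t _; rewrite lee_fin reach_le1// => y; case/andP: (f01 y).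
by rewrite integral_cst// mul1e (le_lt_trans (probability_le1 _ _))// ltry.
Qed.

(** The event that y is the entrance of a trap is independent of the walk up to
its exit from the ball, when y is on the sphere through which it exits. *)
Let integral_reach_dirac j k y : (supnorm y <= (3 * j).+3)%N ->
  \int[Q]_t ((~~ Z t y)%:R * reach (omega t) (Z t) (3 * j).+2 (dirac_fun y) k 0)%:E <=
  (1 - q)%:E * \int[Q]_t (reach (omega t) (Z t) (3 * j).+2 (dirac_fun y) k 0)%:E.
Proof.
set r := (3 * j).+2; move=> yr1.
have r3 : (r %% 3 = 2)%N by rewrite /r; lia.
have [yr|yr] := leqP (supnorm y) r.
  under eq_integral do rewrite reach_dirac_inside// mulr0.
  under [X in _ * X]eq_integral do rewrite reach_dirac_inside//.
  by rewrite integral0 mule0.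
have yE : supnorm y = r.+1 by apply/eqP; rewrite eqn_leq yr yr1.
pose phi t := reach (omega t) (Z t) r (dirac_fun y) k 0.
have dir01 z : (0 <= (dirac_fun y z : R) <= 1)%R by rewrite /dirac_fun ler0n lern1 leq_b1.
have phi0 t : (0 <= phi t)%R by apply: reach_ge0 => // z; case/andP: (dir01 z).
have mphi := @measurable_reachT r (dirac_fun y) k r3.
have mphiE : measurable_fun [set: T] (fun t => (phi t)%:E) by exact/measurable_EFinP.
pose E := rectangle X (trap_bonds d_gt0 y) (trap_range d_gt0 a0 l h y).
have mE : measurable E by apply: measurable_rectangle => // b; exact: measurable_trap_range.
have ZE t : Z t y <-> E t.
  rewrite /E -trapped_rectangle /Z /trap_sites yE /=.
  by rewrite (_ : 3 %| r.+1)%N //= /r; apply/dvdnP; exists j.+1; lia.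
have QE : q%:E <= Q E by rewrite /E -trapped_rectangle.
have indep : \int[Q]_(t in E) (phi t)%:E = Q E * \int[Q]_t (phi t)%:E.
  apply: (@integral_indep R _ T Q _ X mX indX (D r)) => //.
  - by move=> b; exact: measurable_trap_range.
  - move=> b /trap_bondsP[v [->|->]].
    + by case: (bond_at_ends (trap1 d_gt0 y) v) => -[E1 E2] []; rewrite E1 E2 supnorm_trap1 yE ltnn.
    + by case: (bond_at_ends (trap2 d_gt0 y) v) => -[E1 E2] []; rewrite E1 E2 supnorm_trap2 yE ltnNge leqnSn.
  - exact: measurable_reach_sub.
have decomp : \int[Q]_t (phi t)%:E = \int[Q]_(t in E) (phi t)%:E + \int[Q]_(t in ~` E) (phi t)%:E.
  rewrite -[in LHS](setvU E) setUC ge0_integral_setU//.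
  - exact: measurableC.
  - by rewrite setUC setvU.
  - by move=> t _; rewrite lee_fin.
  - by rewrite disj_set2E setICr eqxx.
rewrite (_ : \int[Q]_t _ = \int[Q]_(t in ~` E) (phi t)%:E); last first.
  rewrite [RHS]integral_mkcond; apply: eq_integral => t _; rewrite /patch.
  case: ifPn => [|]; rewrite ?notin_setE ?inE /= => tE.
    by rewrite (_ : Z t y = false) ?mul1r//; apply/negP => /ZE.
  by rewrite (_ : Z t y = true) ?mul0r//; apply/ZE; apply: contrapT.
move: decomp; rewrite indep.
have fphi : \int[Q]_t (phi t)%:E \is a fin_num by exact: integral_reach_fin.
have fE : Q E \is a fin_num by exact: fin_num_measure.
have p0 : 0 <= \int[Q]_t (phi t)%:E by apply: integral_ge0 => t _; rewrite lee_fin.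
have c0 : 0 <= \int[Q]_(t in ~` E) (phi t)%:E by apply: integral_ge0 => t _; rewrite lee_fin.
rewrite -/(phi _) -(fineK fphi) -(fineK fE); move: QE p0 c0.
rewrite -(fineK fphi) -(fineK fE) !lee_fin.
case: (\int[Q]_(t in ~` E) _) => [c| |]; rewrite ?lee_fin //=.
by move=> QE p0 c0 /= []; nra.
Qed.
(** Both sides are decomposed according to the exit point, and compared point by
point. *)
Let integral_reach_step j k :
  \int[Q]_t (reach (omega t) (Z t) (3 * j.+1).+2 (fun=> 1%R) k 0)%:E <=
  (1 - q)%:E * \int[Q]_t (reach (omega t) (Z t) (3 * j).+2 (fun=> 1%R) k 0)%:E.
Proof.
set r := (3 * j).+2; have r3 : (r %% 3 = 2)%N by rewrite /r; lia.
have r3' : ((3 * j.+1).+2 %% 3 = 2)%N by lia.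
have rr : (r < (3 * j.+1).+2)%N by rewrite /r; lia.
have s0 : (supnorm (0 : Zd d) <= r)%N by rewrite supnorm0.
pose y (m : 'rV['I_(2 * r.+1).+1]_d) : Zd d := ball_point m.
pose phi m t := reach (omega t) (Z t) r (dirac_fun (y m)) k 0.
have phi0 m t : (0 <= phi m t)%R by apply: reach_ge0 => // z; exact: ler0n.
have mphi m : measurable_fun [set: T] (phi m) by exact: measurable_reachT.
have q1 : 0 <= (1 - q)%:E by rewrite lee_fin subr_ge0; case/andP: q01.
have mZ m : measurable_fun [set: T] (fun t => ((~~ Z t (y m))%:R * phi m t)%:E).
  apply/measurable_EFinP/measurable_funM => //.
  apply: (@measurableT_comp _ _ _ _ _ _ (fun b : bool => (~~ b)%:R : R)) => //.
  rewrite /Z /trap_sites; case: (3 %| _)%N => //=.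
  apply: (measurable_fun_bool true); rewrite setTI.
  rewrite (_ : _ @^-1` _ = [set t | trapped d_gt0 a0 l h (omega t) (y m)]); last first.
    by apply/seteqP; split.
  rewrite trapped_rectangle; apply: measurable_rectangle => // b.
  exact: measurable_trap_range.
apply: (@le_trans _ _ (\int[Q]_t \sum_m ((~~ Z t (y m))%:R * phi m t)%:E)).
  apply: ge0_le_integral => //.
  - by move=> t _; rewrite lee_fin reach_ge0.
  - by apply/measurable_EFinP; exact: measurable_reachT.
  - by apply: emeasurable_sum => m; exact: mZ.
  - move=> t _; rewrite sumEFin lee_fin.
    by apply: (le_trans (reach_nested d_gt0 (env t) (Z t) k s0 rr)); rewrite reach_sum.
rewrite ge0_integral_sum//; last first.
  by move=> m t _; rewrite lee_fin mulr_ge0.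
rewrite (_ : \int[Q]_t _ = \sum_m \int[Q]_t (phi m t)%:E); last first.
  rewrite -ge0_integral_sum//.
  - apply: eq_integral => t _; rewrite sumEFin reach_sum//; congr (_%:E).
    by apply: eq_bigr => m _; rewrite mul1r.
  - by move=> m; exact/measurable_EFinP.
  - by move=> m t _; rewrite lee_fin.
rewrite ge0_sume_distrr; last by move=> m _; apply: integral_ge0 => t _; rewrite lee_fin.
by apply: lee_sum => m _; apply: integral_reach_dirac; exact: supnorm_ball_point.
Qed.

(** Each of the spheres of radius 3, 6, 9, ... is first reached at a point whose
trap has not been explored, and this costs a factor 1 - q. *)
Lemma integral_reach_le j k :
  \int[Q]_t (reach (omega t) (Z t) (3 * j).+2 (fun=> 1%R) k 0)%:E <= ((1 - q) ^+ j)%:E.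
Proof.
have q1 : 0 <= (1 - q)%:E by rewrite lee_fin subr_ge0; case/andP: q01.
elim: j => [|j IH].
  rewrite expr0; apply: (@le_trans _ _ (\int[Q]_t (cst 1 t))).
    apply: ge0_le_integral => //.
    - by move=> t _; rewrite lee_fin reach_ge0.
    - exact/measurable_EFinP/measurable_reachT.
    - by move=> t _; rewrite lee_fin reach_le1.
  by rewrite integral_cst// mul1e probability_le1.
apply: (le_trans (integral_reach_step j k)); rewrite exprS EFinM.
exact: lee_wpmul2l.
Qed.

(** Markov's inequality, to pass from the average to most environments. *)
Lemma untrapped_prob j k : exists2 A : set T, measurable A &
  Q A <= (4 * (1 - q) ^+ j)%:E /\
  forall t, ~ A t -> (reach (omega t) (Z t) (3 * j).+2 (fun=> 1) k 0 <= 1 / 4)%R.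
Proof.
have r3 : ((3 * j).+2 %% 3 = 2)%N by lia.
pose phi t := reach (omega t) (Z t) (3 * j).+2 (fun=> 1%R) k 0.
have mphi : measurable_fun [set: T] phi by exact: measurable_reachT.
have phi0 t : (0 <= phi t)%R by exact: reach_ge0.
pose A := [set t | (1 / 4 < phi t)%R].
have mA : measurable A.
  rewrite (_ : A = phi @^-1` [set` `]1 / 4, +oo[%R]); last first.
    by apply/seteqP; split => t; rewrite /A /= in_itv /= andbT.
  by rewrite -[X in measurable X]setTI; apply: mphi => //; exact: measurable_itv.
exists A => //; split; last by move=> t /negP; rewrite -leNgt.
rewrite EFinM; apply: (@le_trans _ _ (4%:E * \int[Q]_t (phi t)%:E)); last first.
  by rewrite lee_pmul2l// integral_reach_le.
rewrite -ge0_integralZl//; last 2 first.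
- exact/measurable_EFinP.
- by move=> t _; rewrite lee_fin.
rewrite -[A]setIT -integral_indic//.
apply: ge0_le_integral => //.
- exact/measurable_EFinP/measurable_indic.
- by apply: emeasurable_funM => //; exact/measurable_EFinP.
- move=> t _; rewrite -EFinM lee_fin indicE; case: (boolP (t \in A)) => [|_].
    by rewrite inE /A /= => h1; lra.
  by rewrite mulr_ge0.
Qed.
End annealed.

(** * Probability that a strip is blocked *)

Section finite_products.
Context {R : realType}.
Local Open Scope ereal_scope.

Lemma prode_le (I : Type) (s : seq I) (F : I -> \bar R) (p : R) : (0 <= p)%R ->
  (forall i, 0 <= F i <= p%:E) -> 0 <= \prod_(i <- s) F i <= (p ^+ size s)%:E.
Proof.
move=> p0 Fp; elim: s => [|i s /andP[IH0 IH]]; first by rewrite big_nil expr0 lexx lee01.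
have /andP[Fi0 Fip] := Fp i.
by rewrite big_cons /= exprS EFinM mule_ge0//= lee_pmul.
Qed.

Lemma prode_ge (I : Type) (s : seq I) (F : I -> \bar R) (q : R) : (0 <= q)%R ->
  (forall i, q%:E <= F i) -> (q ^+ size s)%:E <= \prod_(i <- s) F i.
Proof.
move=> q0 Fq; elim: s => [|i s IH]; first by rewrite big_nil expr0.
rewrite big_cons /= exprS EFinM lee_pmul// lee_fin//; exact: exprn_ge0.
Qed.
End finite_products.

Section closed_bonds.
Context {R : realType} {disp : measure_display} {T : measurableType disp}.
Variables (Q : probability T R) (I : choiceType) (X : I -> T -> R).
Hypothesis mX : forall i, measurable_fun setT (X i).
Hypothesis indX : mutually_independent Q X.
Variables (a p : R).
Local Open Scope ereal_scope.
Hypothesis p_ge0 : (0 <= p)%R.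
Hypothesis Xp : forall i, Q [set t | (X i t <= a)%R] <= p%:E.

Lemma union_bound (J : Type) (s : seq J) (A : J -> set T) (c : R) :
  (forall j, measurable (A j)) -> (forall j, Q (A j) <= c%:E) ->
  exists2 B, measurable B & Q B <= ((size s)%:R * c)%:E /\
    forall t j, List.In j s -> A j t -> B t.
Proof.
move=> mA Qc; elim: s => [|j s [B mB [QB sB]]].
  by exists set0 => //; rewrite measure0 mul0r lexx.
exists (A j `|` B); first exact: measurableU.
split; last by move=> t j' /= [<-|js] Aj; [left|right; exact: sB js Aj].
apply: (le_trans (measureU2 _ (mA j) mB)).
by rewrite /= -natr1 mulrDl mul1r addrC EFinD leeD.
Qed.

Lemma all_closed_prob n (e : 'I_n -> I) : injective e ->
  let A := \bigcap_(i in [set: 'I_n]) [set t | (X (e i) t <= a)%R] in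
  measurable A /\ Q A <= (p ^+ n)%:E.
Proof.
move=> inj_e A.
pose J : {fset I} := [fset b in codom e]%fset.
have AE : A = rectangle X J (fun=> [set` `]-oo, a]%R]).
  apply/seteqP; split => t.
  - move=> At b /=; rewrite in_fset /= => /codomP[i ->]; rewrite in_itv /=; exact: At.
  - move=> Jt i _; have := Jt (e i); rewrite /= in_fset /= codom_f => /(_ isT).
    by rewrite in_itv.
split; first by rewrite AE; apply: measurable_rectangle => // b; exact: measurable_itv.
rewrite AE /rectangle indX; last by move=> b; exact: measurable_itv.
have -> : n = size (enum_fset J).
  rewrite (card_imfset _ _ (@inj_id _)) /= undup_id ?size_codom ?card_ord//.
  exact/injectiveP.
have H i : 0 <= Q (X i @^-1` [set` `]-oo, a]%R]) <= p%:E.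
  rewrite measure_ge0 /= (_ : _ @^-1` _ = [set t | (X i t <= a)%R]); first exact: Xp.
  by apply/seteqP; split => t /=; rewrite in_itv.
by have /andP[] := prode_le (enum_fset J) p_ge0 H.
Qed.

(** If each of n lines of L bonds contains a closed bond, then n given bonds are
closed, one in each line; there are L ^ n ways to choose them. *)
Lemma no_open_line_prob n L (e : 'I_n -> 'I_L -> I) :
  (forall s : {ffun 'I_n -> 'I_L}, injective (fun i => e i (s i))) ->
  exists2 A, measurable A & Q A <= ((L ^ n)%:R * p ^+ n)%:E /\
    forall t, ~ A t -> exists i, forall c, (a < X (e i c) t)%R.
Proof.
move=> inj_e.
have [A mA [QA sA]] := @union_bound _ (enum {ffun 'I_n -> 'I_L})
  (fun s => \bigcap_(i in [set: 'I_n]) [set t | (X (e i (s i)) t <= a)%R]) (p ^+ n)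
  (fun s => (all_closed_prob (inj_e s)).1) (fun s => (all_closed_prob (inj_e s)).2).
exists A => //; split; first by move: QA; rewrite -cardT card_ffun !card_ord.
move=> t At; apply: contrapT => H; apply: At.
have /choice[s sP] : forall i, exists c, (X (e i c) t <= a)%R.
  move=> i; apply: contrapT => Hi; apply: H; exists i => c.
  by rewrite ltNge; apply/negP => h; apply: Hi; exists c.
apply: (sA t (finfun s)); last by move=> i _; rewrite /= ffunE; exact: sP.
have : finfun s \in enum {ffun 'I_n -> 'I_L} by rewrite mem_enum.
elim: (enum _) => //= x r IH; rewrite inE => /orP[/eqP ->|/IH]; by [left|right].
Qed.
End closed_bonds.

Section open_strip.
Context {R : realType} {d : nat} {disp : measure_display} {T : measurableType disp}.
Variables (i0 i1 : 'I_d).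
Hypothesis i01 : i0 != i1.
Variables (Q : probability T R) (omega : T -> Zd d -> Zd d -> R).
Hypothesis iid : iid_conductances Q omega.
Variables (a p : R).
Hypothesis p_ge0 : 0 <= p.
Hypothesis Xp : forall b, (Q [set t | (conductance omega b t <= a)%R] <= p%:E)%E.

Lemma plane_point_inj c b c' b' :
  plane_point i0 i1 c b = plane_point i0 i1 c' b' -> c = c' /\ b = b'.
Proof.
move=> /rowP E; split.
  by have := E i0; rewrite !mxE eqxx => -[].
by have := E i1; rewrite !mxE eq_sym (negPf i01) eqxx => -[].
Qed.

Let open (c b c' b' : nat) t :=
  a < omega t (plane_point i0 i1 c b) (plane_point i0 i1 c' b').

(** The first column has to be open, as the path starts at 0: this is only a
bounded number of bonds. Elsewhere blocking takes W closed bonds in one of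
m + 1 bounded regions, and the factor p ^ W beats the factor m + 1. *)
Lemma strip_open_prob W m : (0 < W)%N -> exists2 A, measurable A &
  (Q A <= (W%:R * p + m.+1%:R * ((2 * W) ^ W)%:R * p ^+ W + m.+1%:R * (W ^ W)%:R * p ^+ W)%:E)%E /\
  forall t, ~ A t -> [/\ forall b, (b < W)%N -> open 0 b 0 b.+1 t,
    forall k, (k <= m)%N -> exists2 b, (b < W)%N & forall c, (k * W <= c < k.+2 * W)%N ->
      open c b c.+1 b t &
    forall k, (k <= m)%N -> exists2 c, (k * W <= c < k.+1 * W)%N & forall b, (b < W)%N ->
      open c b c b.+1 t].
Proof.
move=> W0; case: iid => _ mX indX _.
have [A0 mA0 [QA0 A0P]] : exists2 A, measurable A & (Q A <= (W%:R * p)%:E)%E /\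
    forall t, ~ A t -> forall b, (b < W)%N -> open 0 b 0 b.+1 t.
  have [|A mA [QA AP]] := no_open_line_prob mX indX p_ge0 Xp
     (n := 1) (e := fun (_ : 'I_1) (b : 'I_W) => column_bond i0 i1 0 b).
    by move=> s i j _; rewrite !ord1.
  exists A => //; split; first by move: QA; rewrite expn1 expr1.
  move=> t /AP[_ H] b bW; have := H (Ordinal bW).
  by rewrite /conductance column_bond_end.
have [A1 mA1 [QA1 A1P]] : exists2 A, measurable A &
    (Q A <= (m.+1%:R * ((2 * W) ^ W)%:R * p ^+ W)%:E)%E /\
    forall t, ~ A t -> forall k, (k <= m)%N -> exists2 b, (b < W)%N &
      forall c, (k * W <= c < k.+2 * W)%N -> open c b c.+1 b t.
  have H k : exists A : set T, [/\ measurable A,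
      (Q A <= (((2 * W) ^ W)%:R * p ^+ W)%:E)%E &
      forall t, ~ A t -> exists2 b, (b < W)%N &
        forall c, (k * W <= c < k.+2 * W)%N -> open c b c.+1 b t].
    have [|A mA [QA AP]] := no_open_line_prob mX indX p_ge0 Xp
       (n := W) (e := fun (b : 'I_W) (c : 'I_(2 * W)) => row_bond i0 i1 (k * W + c) b).
      by move=> s i j /= [/plane_point_inj[_ h]]; exact: val_inj.
    exists A; split => // t /AP[b H]; exists b => // c ck.
    have cW : (c - k * W < 2 * W)%N by move: ck; rewrite !mulSn; lia.
    have E : (k * W + Ordinal cW = c)%N by rewrite /= subnKC//; case/andP: ck.
    by have := H (Ordinal cW); rewrite E /conductance row_bond_end.
  have /choice[A AP] := H.
  have [|j|B mB [QB BP]] := union_bound (Q := Q) (iota 0 m.+1) (A := A) (c := ((2 * W) ^ W)%:R * p ^+ W).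
  - by move=> j; case: (AP j).
  - by case: (AP j).
  exists B => //; split; first by move: QB; rewrite size_iota mulrA.
  move=> t Bt k km; case: (AP k) => _ _; apply => Akt; apply: Bt; apply: BP Akt.
  have : k \in iota 0 m.+1 by rewrite mem_iota.
  elim: (iota _ _) => //= x r IH; rewrite inE => /orP[/eqP ->|/IH]; by [left|right].
have [A2 mA2 [QA2 A2P]] : exists2 A, measurable A &
    (Q A <= (m.+1%:R * (W ^ W)%:R * p ^+ W)%:E)%E /\
    forall t, ~ A t -> forall k, (k <= m)%N -> exists2 c, (k * W <= c < k.+1 * W)%N &
      forall b, (b < W)%N -> open c b c b.+1 t.
  have H k : exists A : set T, [/\ measurable A,
      (Q A <= ((W ^ W)%:R * p ^+ W)%:E)%E &
      forall t, ~ A t -> exists2 c, (k * W <= c < k.+1 * W)%N &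
        forall b, (b < W)%N -> open c b c b.+1 t].
    have [|A mA [QA AP]] := no_open_line_prob mX indX p_ge0 Xp
       (n := W) (e := fun (c : 'I_W) (b : 'I_W) => column_bond i0 i1 (k * W + c) b).
      by move=> s i j /= [/plane_point_inj[/addnI h _]]; exact: val_inj.
    exists A; split => // t /AP[c H]; exists (k * W + c)%N.
      by rewrite leq_addr /= mulSn addnC ltn_add2r.
    by move=> b bW; have := H (Ordinal bW); rewrite /conductance column_bond_end.
  have /choice[A AP] := H.
  have [|j|B mB [QB BP]] := union_bound (Q := Q) (iota 0 m.+1) (A := A) (c := (W ^ W)%:R * p ^+ W).
  - by move=> j; case: (AP j).
  - by case: (AP j).
  exists B => //; split; first by move: QB; rewrite size_iota mulrA.
  move=> t Bt k km; case: (AP k) => _ _; apply => Akt; apply: Bt; apply: BP Akt.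
  have : k \in iota 0 m.+1 by rewrite mem_iota.
  elim: (iota _ _) => //= x r IH; rewrite inE => /orP[/eqP ->|/IH]; by [left|right].
exists (A0 `|` A1 `|` A2); first by apply: measurableU => //; exact: measurableU.
split.
  apply: le_trans (measureU2 _ (measurableU _ _ mA0 mA1) mA2) _.
  rewrite EFinD leeD// EFinD; apply: le_trans (measureU2 _ mA0 mA1) _.
  exact: leeD.
move=> t /not_orP[/not_orP[n0 n1] n2]; split; [exact: A0P|exact: A1P|exact: A2P].
Qed.
End open_strip.

(** * Consequences of the tail of the conductances *)

Section tail.
Context {R : realType} {d : nat} {disp : measure_display} {T : measurableType disp}.
Hypothesis d_gt0 : (0 < d)%N.
Variables (Q : probability T R) (omega : T -> Zd d -> Zd d -> R) (gamma : R).
Hypothesis gamma_gt0 : 0 < gamma.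
Hypothesis iid : iid_conductances Q omega.
Hypothesis tail : lower_tail Q omega gamma.

Let X b t := conductance omega b t.

Let measurable_le b a : measurable [set t | (X b t <= a)%R].
Proof.
rewrite (_ : [set t | _] = X b @^-1` [set` `]-oo, a]]); last first.
  by apply/seteqP; split => t; rewrite /= in_itv.
rewrite -[X in measurable X]setTI; by case: iid => _ mX _ _; apply: mX.
Qed.

(** The threshold is uniform in b since the bonds have the same law. *)
Lemma tail_bounds : exists2 s : R, 0 < s & forall b a, 0 < a <= s ->
  ((3 / 4 * a `^ gamma)%:E <= Q [set t | (X b t <= a)%R] <= (5 / 4 * a `^ gamma)%:E)%E.
Proof.
pose b0 : bond d := (0, Ordinal d_gt0).
have := tail b0 => /cvgrPdist_lt /(_ (1 / 4)) /(_ ltac:(lra)).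
rewrite near_withinE => -[e /= e0 He].
exists (e / 2); first by rewrite divr_gt0.
move=> b a /andP[a0 ae].
have -> : Q [set t | (X b t <= a)%R] = Q [set t | (X b0 t <= a)%R].
  case: iid => _ _ _ same.
  have := same b b0 [set` `]-oo, a]] (measurable_itv _).
  have E c : conductance omega c @^-1` [set` `]-oo, a]] = [set t | (X c t <= a)%R].
    by apply/seteqP; split => t; rewrite /= in_itv.
  by rewrite !E.
have ag : 0 < a `^ gamma by rewrite powR_gt0.
have ea : ball 0 e a.
  rewrite /ball /= sub0r normrN gtr0_norm//; apply: le_lt_trans ae _.
  by rewrite ltr_pdivrMr// mulr_natr mulr2n ltrDl.
have h0 := He a ea a0; rewrite -[Q _]fineK ?fin_num_measure// !lee_fin.
move: h0; set f := fine _; rewrite ltr_norml => /andP[h1 h2].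
have fE : f / a `^ gamma * a `^ gamma = f by rewrite divfK// gt_eqF.
by apply/andP; split; rewrite -fE; nra.
Qed.

Lemma trap_prob_ge (a0 l h q : R) z : 0 <= q <= 1 -> l <= h ->
  (forall b, q%:E <= Q [set t | (a0 < X b t)%R])%E ->
  (forall b, q%:E <= Q [set t | (l < X b t <= h)%R])%E ->
  ((q ^+ (4 * d))%:E <= Q [set t | trapped d_gt0 a0 l h (omega t) z])%E.
Proof.
move=> /andP[q0 q1] lh Qa Qlh.
rewrite (trapped_rectangle d_gt0 iid) /rectangle; case: (iid) => _ mX indX _.
rewrite indX; last exact: measurable_trap_range.
apply: (@le_trans _ _ (q ^+ size (enum_fset (trap_bonds d_gt0 z)))%:E).
  by rewrite lee_fin ler_wiXn2l//; exact: card_trap_bonds.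
apply: prode_ge => // b; rewrite /trap_range; case: ifP => _.
- apply: le_trans (Qa b) _; apply: le_measure; rewrite ?inE.
  + rewrite (_ : [set t | _] = X b @^-1` [set` `]a0, +oo[]); last first.
      by apply/seteqP; split => t; rewrite /= in_itv /= andbT.
    by rewrite -[X in measurable X]setTI; apply: mX.
  + by rewrite -[X in measurable X]setTI; apply: mX.
  + by move=> t; rewrite /= in_itv /= andbT.
- apply: le_trans (Qlh b) _; apply: le_measure; rewrite ?inE.
  + rewrite (_ : [set t | _] = X b @^-1` [set` `]l, h]]); last first.
      by apply/seteqP; split => t; rewrite /= in_itv.
    by rewrite -[X in measurable X]setTI; apply: mX.
  + by rewrite -[X in measurable X]setTI; apply: mX.
  + by move=> t; rewrite /= in_itv.
Qed.

Lemma interval_prob_ge (s k h : R) b :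
  (forall b a, 0 < a <= s ->
    ((3 / 4 * a `^ gamma)%:E <= Q [set t | (X b t <= a)%R] <= (5 / 4 * a `^ gamma)%:E)%E) ->
  0 < k <= 1 -> k `^ gamma = 1 / 5 -> 0 < h <= s ->
  ((h `^ gamma / 2)%:E <= Q [set t | (k * h < X b t <= h)%R])%E.
Proof.
move=> Hs /andP[k0 k1] kg /andP[h0 hs].
have kh : 0 < k * h by rewrite mulr_gt0.
have khh : k * h <= h by rewrite ler_piMl// ltW.
have /andP[H1 _] : ((3 / 4 * h `^ gamma)%:E <= Q [set t | (X b t <= h)%R] <= (5 / 4 * h `^ gamma)%:E)%E.
  by apply: Hs; rewrite h0.
have /andP[_ H2] : ((3 / 4 * (k * h) `^ gamma)%:E <= Q [set t | (X b t <= k * h)%R] <= (5 / 4 * (k * h) `^ gamma)%:E)%E.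
  by apply: Hs; rewrite kh (le_trans khh).
have kE : (k * h) `^ gamma = h `^ gamma / 5.
  by rewrite powRM ?(ltW k0) ?(ltW h0)// kg mulrC mul1r.
have D := measureDI Q (measurable_le b h) (measurable_le b (k * h)).
move: D; rewrite (_ : _ `\` _ = [set t | (k * h < X b t <= h)%R]); last first.
  apply/seteqP; split => t /=; first by move=> [-> /negP]; rewrite -ltNge => ->.
  by move=> /andP[h1 h2]; split => //; apply/negP; rewrite -ltNge.
rewrite (_ : _ `&` _ = [set t | (X b t <= k * h)%R]); last first.
  apply/seteqP; split => t /=; first by case.
  by move=> h1; split => //; exact: le_trans khh.
move: H1 H2; rewrite kE => H1 H2 D.
have : ((3 / 4 * h `^ gamma)%:E <= Q [set t | (k * h < X b t <= h)%R] + (5 / 4 * (h `^ gamma / 5))%:E)%E.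
  by apply: le_trans H1 _; rewrite D leeD.
rewrite -leeBlDr// -EFinB; apply: le_trans; rewrite lee_fin.
by have : 0 <= h `^ gamma by [exact: powR_ge0]; lra.
Qed.

Lemma large_prob_ge (s a : R) b :
  (forall b a, 0 < a <= s ->
    ((3 / 4 * a `^ gamma)%:E <= Q [set t | (X b t <= a)%R] <= (5 / 4 * a `^ gamma)%:E)%E) ->
  0 < a <= s -> a `^ gamma <= 2 / 5 -> ((1 / 2)%:E <= Q [set t | (a < X b t)%R])%E.
Proof.
move=> Hs as' ag; have /andP[_ H] := Hs b a as'.
have -> : [set t | (a < X b t)%R] = ~` [set t | (X b t <= a)%R].
  by apply/seteqP; split => t /=; [rewrite ltNge => /negP|move=> /negP; rewrite -ltNge].
rewrite probability_setC//; rewrite -(fineK (fin_num_measure Q _ (measurable_le b a))) in H *.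
by rewrite -EFinB !lee_fin in H *; lra.
Qed.
End tail.

(** * Arithmetic of the scales *)

(** At scale N = 4^i, the parameter y stands for N^(gamma / 2), and M for
N^(1 / 2). A trap has probability of order y^(-8d), a closed bond of order 1/y,
and J, of order y^(9d), is the number of spheres. *)
Section scale_arithmetic.
Context {R : realType}.
Implicit Types (y q c : R) (d J : nat).

Lemma geometric_decay y c : 0 <= y < 1 -> 0 < c -> exists i1, forall i, (i1 <= i)%N -> y ^+ i <= c.
Proof.
move=> /andP[y0 y1] c0.
have /cvgrPdist_le /(_ c c0) [i1 _ H] : (GRing.exp y : R ^nat) @ \oo --> 0.
  by apply: cvg_expr; rewrite ger0_norm.
exists i1 => i ii1; have := H i ii1.
by rewrite sub0r normrN ger0_norm// exprn_ge0.
Qed.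

Lemma survival_bernoulli q J : 0 <= q <= 1 -> (1 - q) ^+ J * (1 + J%:R * q) <= 1.
Proof.
move=> /andP[q0 q1]; elim: J => [|J IH]; first by rewrite mul0r addr0 mulr1 expr0.
apply: le_trans IH; rewrite exprSr -mulrA.
apply: ler_wpM2l; first by rewrite exprn_ge0// subr_ge0.
by rewrite -natr1; have : 0 <= J%:R :> R by []; nra.
Qed.

Lemma sphere_count_bounds y d : 1 <= y ->
  y ^+ d <= (Num.truncn (y ^+ d)).+1%:R <= 2 * y ^+ d.
Proof.
move=> y1; have yd : 1 <= y ^+ d by exact: exprn_ege1.
have := @truncn_itv R (y ^+ d); rewrite (le_trans ler01 yd) => /(_ isT) /andP[h1 h2].
by rewrite ltW//= -natr1; lra.
Qed.

Lemma untrapped_le c y d J : 0 < c -> 1 <= y -> (0 < d)%N -> y ^+ (9 * d) <= J%:R ->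
  (c / y ^+ 2) ^+ (4 * d) <= 1 ->
  (1 - (c / y ^+ 2) ^+ (4 * d)) ^+ J <= (c ^+ (4 * d))^-1 / y.
Proof.
move=> c0 y1 d0 yJ q1; have y0 : 0 < y by lra.
set q := _ ^+ (4 * d) in q1 *.
have q0 : 0 <= q by rewrite exprn_ge0// divr_ge0 ?exprn_ge0// ltW.
have cd : 0 < c ^+ (4 * d) by exact: exprn_gt0.
have h1 : c ^+ (4 * d) * y <= J%:R * q.
  apply: (@le_trans _ _ (y ^+ (9 * d) * q)); last by rewrite ler_wpM2r.
  rewrite /q expr_div_n -exprM (_ : 9 * d = 2 * (4 * d) + d)%N; last by lia.
  have yd : 0 < y ^+ (2 * (4 * d)) by exact: exprn_gt0.
  rewrite exprD; move: (y ^+ _) yd => A A0.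
  rewrite [leRHS]mulrC mulrA divfK ?gt_eqF// ler_pM2l// -[leLHS]expr1; exact: ler_weXn2l.
have := @survival_bernoulli q J; rewrite q0 q1 => /(_ isT) h2.
rewrite -invfM -[leRHS]mul1r ler_pdivlMr; last by rewrite mulr_gt0.
apply: le_trans h2; apply: ler_wpM2l; first by rewrite exprn_ge0// subr_ge0.
by lra.
Qed.

Lemma strip_le y d J : 1 <= y -> (0 < d)%N -> (0 < J)%N -> J%:R <= 2 * y ^+ (9 * d) ->
  (3 * J + 4)%:R * (5 / 4 / y) ^+ (10 * d) <= 14 * (5 / 4) ^+ (10 * d) / y.
Proof.
move=> y1 d0 J0 yJ; have y0 : 0 < y by lra.
have J1 : 1 <= J%:R :> R by rewrite ler1n.
have h1 : (3 * J + 4)%:R <= 14 * y ^+ (9 * d).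
  by rewrite natrD natrM; lra.
rewrite expr_div_n; set K := (5 / 4) ^+ (10 * d).
have K0 : 0 <= K by rewrite exprn_ge0.
have yd : 0 < y ^+ (10 * d) by exact: exprn_gt0.
apply: (@le_trans _ _ (14 * y ^+ (9 * d) * (K / y ^+ (10 * d)))).
  by apply: ler_wpM2r => //; rewrite divr_ge0// ltW.
rewrite -!mulrA ler_pM2l// mulrCA; apply: ler_wpM2l => //.
rewrite (_ : 10 * d = 9 * d + d)%N; last by lia.
rewrite exprD invfM mulrA divff ?mul1r; last by rewrite gt_eqF// exprn_gt0.
rewrite lef_pV2 ?posrE ?exprn_gt0// -[leLHS]expr1; exact: ler_weXn2l.
Qed.

Lemma box_size_le y d J (M : R) : 1 <= y -> (0 < J)%N -> J%:R <= 2 * y ^+ (9 * d) ->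
  0 <= M ->
  (8 * d)%:R * 11 ^+ d * (250 * d)%:R * 2 ^+ d.+1 * y ^+ (9 * d * d.+1) <= M ->
  (8 * d)%:R * ((2 * (3 * J).+2).+1 ^ d)%:R *
    ((10 * d + (3 * J + 3) * (4 * (10 * d)))%:R / M^-1) <= M ^+ 2.
Proof.
move=> y1 J0 yJ M0 H; have J1 : 1 <= J%:R :> R by rewrite ler1n.
rewrite invrK mulrA expr2 ler_wpM2r//; apply: le_trans H.
have h1 : ((2 * (3 * J).+2).+1 ^ d)%:R <= 11 ^+ d * J%:R ^+ d :> R.
  rewrite natrX -exprMn; apply: lerXn2r; rewrite ?nnegrE//.
  by rewrite -natrM ler_nat; lia.
have h2 : (10 * d + (3 * J + 3) * (4 * (10 * d)))%:R <= (250 * d)%:R * J%:R :> R.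
  by rewrite -natrM ler_nat; nia.
have h3 : J%:R ^+ d.+1 <= 2 ^+ d.+1 * y ^+ (9 * d * d.+1) :> R.
  by rewrite exprM -exprMn; apply: lerXn2r; rewrite ?nnegrE// (le_trans _ yJ).
apply: (@le_trans _ _ ((8 * d)%:R * (11 ^+ d * J%:R ^+ d) * ((250 * d)%:R * J%:R))).
  by apply: ler_pM => //; rewrite ?mulr_ge0//; apply: ler_wpM2l.
rewrite (_ : _ * _ * _ = (8 * d)%:R * 11 ^+ d * (250 * d)%:R * J%:R ^+ d.+1); last first.
  by rewrite exprS; move: (J%:R ^+ d) (11 ^+ d) => A B; ring.
rewrite -[leRHS]mulrA; apply: ler_wpM2l h3.
by rewrite !mulr_ge0// exprn_ge0.
Qed.

Lemma final_le y d J n (L : R) (N : R) (gd : R) : 0 < N -> (0 < d)%N -> 1 <= y ->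
  (0 < J)%N -> J%:R <= 2 * y ^+ (9 * d) -> 0 <= L -> N <= n%:R -> y ^+ (9 * d * d) <= gd ->
  L ^+ 2 / 30 ^+ d / (n%:R ^+ 2 * gd) <=
  (L / N) ^+ 2 / ((2 * (3 * J).+4).+1 ^ d)%:R.
Proof.
move=> N0 d0 y1 J0 yJ L0 Nn ygd.
have y0 : 0 < y by lra.
have J1 : 1 <= J%:R :> R by rewrite ler1n.
have yd : 0 < y ^+ (9 * d * d) by exact: exprn_gt0.
have b0 : 0 < ((2 * (3 * J).+4).+1 ^ d)%:R :> R by rewrite ltr0n expn_gt0.
have n0 : 0 < n%:R :> R by apply: lt_le_trans Nn.
have h1 : ((2 * (3 * J).+4).+1 ^ d)%:R <= 30 ^+ d * y ^+ (9 * d * d) :> R.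
  rewrite natrX exprM -exprMn; apply: lerXn2r; rewrite ?nnegrE// ?mulr_ge0 ?exprn_ge0 ?(ltW y0)//.
  have -> : ((2 * (3 * J).+4).+1)%:R = 6 * J%:R + 9 :> R.
    have -> : ((2 * (3 * J).+4).+1 = 6 * J + 9)%N by clear; lia.
    by rewrite natrD natrM.
  by lra.
rewrite expr_div_n -[leLHS]mulrA -[leRHS]mulrA -!invfM; apply: ler_wpM2l; first exact: exprn_ge0.
have gd0 : 0 < gd by exact: lt_le_trans ygd.
rewrite lef_pV2 ?posrE ?mulr_gt0 ?exprn_gt0//.
rewrite mulrCA; apply: ler_pM; rewrite ?exprn_ge0 ?(ltW N0)//.
  by apply: lerXn2r; rewrite ?nnegrE ?(ltW N0) ?(ltW n0).
by apply: le_trans h1 _; rewrite ler_wpM2l// exprn_ge0.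
Qed.
End scale_arithmetic.

(** * The event that a scale is good *)

Section scales.
Context {R : realType} {d : nat} {disp : measure_display} {T : measurableType disp}.
Hypothesis d_gt1 : (1 < d)%N.
Variables (Q : probability T R) (omega : T -> Zd d -> Zd d -> R) (gamma : R).
Hypothesis gamma_gt0 : 0 < gamma.
Hypothesis gamma_small : (9 * d * d.+1)%:R * gamma < 1.
Hypothesis iid : iid_conductances Q omega.
Hypothesis tail : lower_tail Q omega gamma.

Let theta : R := 2 `^ gamma.

Lemma powR_exp2 i : (2 ^+ i) `^ gamma = theta ^+ i.
Proof. rewrite -(@powR_mulrn R theta i (powR_ge0 _ _)) -(@powR_mulrn R 2 i (ler0n _ _)).
by rewrite /theta -(powRrM 2 gamma i%:R) -(powRrM 2 i%:R gamma) mulrC. Qed.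

Lemma powR_inv (x : R) : 0 < x -> (x^-1) `^ gamma = (x `^ gamma)^-1.
Proof.
move=> x0; have xg : x `^ gamma != 0 by rewrite gt_eqF// powR_gt0.
apply: (mulIf xg); rewrite mulVf// -powRM ?invr_ge0 ?(ltW x0)//.
by rewrite mulVf ?gt_eqF// powR1.
Qed.

Lemma theta_gt1 : 1 < theta.
Proof.
have := @gt0_ltr_powR R gamma gamma_gt0 1 2.
by rewrite !nnegrE powR1; apply => //; rewrite ltr1n.
Qed.

(** With y = theta ^ i, this says that y ^ (9d(d + 1)), the order of the volume
of the ball times the length of the path, is much smaller than 2 ^ i. *)
Lemma theta_small : theta ^+ (9 * d * d.+1) < 2.
Proof.
rewrite -powR_mulrn ?powR_ge0// -powRrM -[ltRHS](@powRr1 R 2)// mulrC.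
by rewrite /powR ?pnatr_eq0 /= ltr_expR ltr_pM2r// ln_gt0// ltr1n.
Qed.

(** The two bad events are that the walk is likely to leave the ball without
meeting a trap, and that the strip is blocked; each has a probability of order
1/y = theta ^ -i. *)
Lemma scale_event : exists C c i1, [/\ 0 <= C, 0 < c & forall i, (i1 <= i)%N ->
  exists2 A, measurable A & (Q A <= (C * theta^-1 ^+ i)%:E)%E /\
  forall t, ~ A t -> (forall x, total_conductance (omega t) x <= (2 * d)%:R) ->
  forall n, (4 ^ i <= n <= 4 * 4 ^ i)%N ->
    c * total_conductance (omega t) 0 / (n%:R ^+ 2 * (n%:R `^ gamma) ^+ (9 * d * d))
    <= transition_n (omega t) (2 * n) 0 0].
Proof.
have d_gt0 : (0 < d)%N by exact: ltnW.
pose i0 : 'I_d := Ordinal d_gt0; pose j0 : 'I_d := Ordinal d_gt1.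
have ij : i0 != j0 by [].
have [s' s'0 Hs'] := tail_bounds d_gt0 iid tail.
pose s := Num.min s' 1.
have s0 : 0 < s by rewrite lt_min s'0 ltr01.
have s1 : s <= 1 by rewrite ge_min lexx orbT.
have Hs b a : 0 < a <= s -> ((3 / 4 * a `^ gamma)%:E <= Q [set t | (conductance omega b t <= a)%R]
    <= (5 / 4 * a `^ gamma)%:E)%E.
  by move=> /andP[a0 as']; apply: Hs'; rewrite a0 (le_trans as')// ge_min lexx.
have g'0 : 0 <= gamma^-1 by rewrite invr_ge0 ltW.
have root (x : R) : 0 < x -> (x `^ gamma^-1) `^ gamma = x.
  by move=> x0; rewrite -powRrM mulVf ?gt_eqF// powRr1// ltW.
(* A bond is stronger than a0 with probability at least 1/2. *)
pose a0 := Num.min s ((2 / 5) `^ gamma^-1).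
have a00 : 0 < a0 by rewrite lt_min s0 powR_gt0.
have a0s : a0 <= s by rewrite ge_min lexx.
have a0g : a0 `^ gamma <= 2 / 5.
  rewrite -[leRHS]root//; apply: ge0_ler_powR; rewrite ?nnegrE ?powR_ge0 ?(ltW a00) ?(ltW gamma_gt0)//.
  by rewrite ge_min lexx orbT.
(* The walls of a trap have conductance in ]kh, h], where k makes the
probability of this interval at least h^gamma / 2. *)
pose k : R := (1 / 5) `^ gamma^-1.
have k0 : 0 < k by rewrite powR_gt0.
have kg : k `^ gamma = 1 / 5 by rewrite root.
have k1 : k <= 1.
  have -> : 1 = 1 `^ gamma^-1 :> R by rewrite powR1.
  by apply: ge0_ler_powR => //; rewrite ?nnegrE//; lra.
have d1 : 1 <= d%:R :> R by rewrite ler1n.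
(* The walls are at most e / N, which makes the walk stay in the trap up to time
4N with probability at least 1/2. *)
pose e := a0 / (16 * d)%:R.
have e0 : 0 < e by rewrite divr_gt0// ltr0n muln_gt0.
have ea0 : e <= a0.
  by rewrite ler_pdivrMr ?ltr0n ?muln_gt0// natrM ler_peMr ?(ltW a00)//; lra.
pose c1 := e `^ gamma / 2.
have c10 : 0 < c1 by rewrite divr_gt0// powR_gt0.
pose K := 14 * (5 / 4) ^+ (10 * d) : R.
(* The width of the strip is such that y^W exceeds its length, of order y^(9d),
by a factor y^d. *)
pose W := (10 * d)%N.
pose C := W%:R * (5 / 4) + ((2 * W) ^ W)%:R * K + (W ^ W)%:R * K + 4 * (c1 ^+ (4 * d))^-1.
pose L := k * e / (8 * d)%:R.
have L0 : 0 < L by apply: divr_gt0; [exact: mulr_gt0|rewrite ltr0n muln_gt0].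
pose c := L ^+ 2 / 30 ^+ d / (2 * d)%:R.
pose S : R := (8 * d)%:R * 11 ^+ d * (250 * d)%:R * 2 ^+ d.+1.
have S0 : 0 < S.
  by rewrite /S; repeat apply: mulr_gt0; rewrite ?exprn_gt0 ?ltr0n ?muln_gt0.
have th1 := theta_gt1; have th0 : 0 < theta by exact: lt_trans th1.
have [i2 Hi2] : exists i2, forall i, (i2 <= i)%N -> (2^-1 : R) ^+ i <= s.
  by apply: geometric_decay => //; lra.
have [i3 Hi3] : exists i3, forall i, (i3 <= i)%N -> (theta ^+ (9 * d * d.+1) / 2) ^+ i <= S^-1.
  apply: geometric_decay; last by rewrite invr_gt0.
  rewrite divr_ge0 ?exprn_ge0 ?(ltW th0)//= ltr_pdivrMr// mul1r; exact: theta_small.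
exists C, c, (maxn i2 i3); split.
- have K0 : 0 <= K by rewrite mulr_ge0// exprn_ge0.
  by rewrite !addr_ge0 ?mulr_ge0 ?invr_ge0 ?exprn_ge0// ?ltW//; lra.
- by rewrite /c divr_gt0 ?ltr0n ?muln_gt0// divr_gt0 ?exprn_gt0.
move=> i; rewrite geq_max => /andP[ii2 ii3].
pose M : R := 2 ^+ i; pose y := theta ^+ i.
have M0 : 0 < M by exact: exprn_gt0.
have y1 : 1 <= y by apply: exprn_ege1; exact: ltW.
have y0 : 0 < y by lra.
have Mg : M `^ gamma = y by exact: powR_exp2.
have NE : (4 ^ i)%:R = M ^+ 2 :> R.
  have E4 : 4 = 2 ^+ 2 :> R by rewrite expr2 -natrM.
  by rewrite natrX E4 /M -!exprM mulnC.
have M1 : 1 <= M by apply: exprn_ege1; rewrite ler1n.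
have N0 : 0 < (4 ^ i)%:R :> R by rewrite NE exprn_gt0.
have N1 : 1 <= (4 ^ i)%:R :> R by rewrite NE exprn_ege1.
pose J := (Num.truncn (y ^+ (9 * d))).+1.
have /andP[yJ Jy] := sphere_count_bounds (9 * d) y1; rewrite -/J in yJ Jy.
have J0 : (0 < J)%N by [].
pose h := e / (4 ^ i)%:R; pose l := k * h.
have h0 : 0 < h by rewrite divr_gt0.
have hs : h <= s.
  by apply: le_trans a0s; apply: le_trans ea0; rewrite ler_pdivrMr// ler_peMr// ltW.
have hg : h `^ gamma / 2 = c1 / y ^+ 2.
  rewrite /h powRM ?(ltW e0) ?invr_ge0 ?(ltW N0)// powR_inv// NE expr2 powRM ?(ltW M0)// Mg -expr2.
  by rewrite /c1; field; rewrite gt_eqF.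
have q01 : 0 <= h `^ gamma / 2 <= 1.
  rewrite divr_ge0 ?powR_ge0//= ler_pdivrMr// mul1r; apply: (@le_trans _ _ 1); last by lra.
  have -> : 1 = 1 `^ gamma :> R by rewrite powR1.
  by apply: ge0_ler_powR; rewrite ?nnegrE ?(ltW gamma_gt0) ?(ltW h0)// (le_trans hs).
have Qtrap z : (((c1 / y ^+ 2) ^+ (4 * d))%:E <= Q [set t | trapped d_gt0 a0 l h (omega t) z])%E.
  rewrite -hg; apply: (trap_prob_ge d_gt0 iid) => //.
  - by rewrite /l ler_piMl// ltW.
  - move=> b; apply: le_trans (large_prob_ge iid b Hs _ a0g); last by rewrite a00.
    rewrite lee_fin ler_pM2r ?invr_gt0//.
    have -> : 1 = 1 `^ gamma :> R by rewrite powR1.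
    by apply: ge0_ler_powR; rewrite ?nnegrE ?(ltW gamma_gt0) ?(ltW h0)// (le_trans hs).
  - by move=> b; apply: (interval_prob_ge iid b Hs) => //; rewrite ?k0 ?h0.
rewrite hg in q01; set q := (c1 / y ^+ 2) ^+ (4 * d) in Qtrap *.
have q01' : 0 <= q <= 1.
  by case/andP: q01 => qa qb; rewrite /q exprn_ge0//= exprn_ile1.
have [A mA [QA AP]] := untrapped_prob iid q01' Qtrap J (4 ^ i).
have p0 : 0 <= 5 / 4 / y by rewrite divr_ge0 ?(ltW y0)//; lra.
have Xp b : (Q [set t | (conductance omega b t <= M^-1)%R] <= (5 / 4 / y)%:E)%E.
  have /andP[_] : ((3 / 4 * M^-1 `^ gamma)%:E <= Q [set t | (conductance omega b t <= M^-1)%R]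
    <= (5 / 4 * M^-1 `^ gamma)%:E)%E.
    by apply: Hs; rewrite invr_gt0 M0 -exprVn; exact: Hi2.
  by rewrite powR_inv// Mg.
have W0 : (0 < W)%N by rewrite muln_gt0.
have [B mB [QB BP]] := strip_open_prob ij iid p0 Xp (3 * J + 3) W0.
exists (A `|` B); first exact: measurableU.
split.
  apply: (le_trans (measureU2 _ mA mB)); apply: (le_trans (leeD QA QB)).
  rewrite -EFinD lee_fin exprVn -/y.
  have u1 := untrapped_le c10 y1 d_gt0 yJ (andP q01').2.
  have u2 := strip_le y1 d_gt0 J0 Jy.
  have -> : C / y = 4 * ((c1 ^+ (4 * d))^-1 / y) + (W%:R * (5 / 4 / y) +
     ((2 * W) ^ W)%:R * (K / y) + (W ^ W)%:R * (K / y)).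
    rewrite /C; move: (c1 ^+ _)^-1 (((2 * W) ^ W)%:R) ((W ^ W)%:R) (W%:R) (K) => r1 r2 r3 r4 r5.
    by field; rewrite gt_eqF.
  rewrite (_ : (3 * J + 3).+1 = 3 * J + 4)%N; last by clear; lia.
  apply: lerD; first by rewrite ler_pM2l.
  rewrite -!addrA; apply: lerD => //; apply: lerD.
    by rewrite [leLHS]mulrAC [leLHS]mulrC; apply: ler_wpM2l.
  by rewrite [leLHS]mulrAC [leLHS]mulrC; apply: ler_wpM2l.
move=> t /not_orP[At Bt] tc n /andP[n1 n2]; have [r1 r2 r3] := BP t Bt.
have env : environment (omega t) by case: iid.
have l01 : 0 <= l <= 1.
  rewrite /l mulr_ge0 ?(ltW k0) ?(ltW h0)//= mulr_ile1 ?(ltW k0) ?(ltW h0)//.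
  exact: le_trans hs s1.
have size := @box_size_le R y d J M y1 J0 Jy (ltW M0) _.
have hh : (4 * 4 ^ i)%:R * ((2 * d)%:R * h / a0) <= 1 / 2.
  rewrite /h /e !natrM le_eqVlt; apply/orP; left; apply/eqP.
  move: N0; move: ((4 ^ i)%:R) => N N0; field; rewrite !gt_eqF//; lra.
have := @return_ge_of_traps R d d_gt0 i0 j0 (omega t) a0 l h M^-1 W (3 * J + 3) (3 * J).+2 (4 ^ i) n
  ij env tc a00 (ltW h0) l01 _ W0 _ _ r1 r2 r3 _ hh (AP t At) _.
move=> H; apply: le_trans (H _ _ _ _ _).
- have Nn : (4 ^ i)%:R <= n%:R :> R by rewrite ler_nat.
  have ygd : y ^+ (9 * d * d) <= (n%:R `^ gamma) ^+ (9 * d * d).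
    apply: lerXn2r; rewrite ?nnegrE ?powR_ge0 ?(ltW y0)// -Mg.
    apply: ge0_ler_powR; rewrite ?nnegrE ?(ltW gamma_gt0) ?(ltW M0)//.
    by apply: le_trans Nn; rewrite NE expr2 ler_peMl// ltW.
  have F := final_le N0 d_gt0 y1 J0 Jy (ltW L0) Nn ygd.
  have t0 : 0 <= total_conductance (omega t) 0 / (2 * d)%:R.
    by rewrite divr_ge0// ltW// total_conductance_gt0.
  have -> : l / (8 * d)%:R = L / (4 ^ i)%:R.
    by rewrite /l /h /L !mulrA mulrAC.
  rewrite -[leRHS]mulrA; apply: le_trans (ler_wpM2l t0 F).
  rewrite le_eqVlt; apply/orP; left; apply/eqP; rewrite /c.
  move: (_ * _ ^+ (9 * d * d)) (30 ^+ d) => X Y; ring.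
- by rewrite invr_gt0.
- by rewrite /W; clear -d_gt0; nia.
- by rewrite expn_gt0.
- rewrite NE; apply: size.
  rewrite -/S -(@ler_pM2l _ S^-1) ?invr_gt0// mulrA mulVf ?gt_eqF// mul1r.
  have := Hi3 i ii3; rewrite expr_div_n -exprM mulnC exprM -/y -/M ler_pdivrMr//.
- by rewrite n1 n2.
Qed.
End scales.

(** * Almost sure statements *)

Section almost_sure.
Context {R : realType} {d : nat} {disp : measure_display} {T : measurableType disp}.
Variables (Q : probability T R) (omega : T -> Zd d -> Zd d -> R).

Lemma total_conductance_le (w : Zd d -> Zd d -> R) x : environment w ->
  (forall b : bond d, w b.1 (bond_end b) <= 1) -> total_conductance w x <= (2 * d)%:R.
Proof.
move=> env w1; rewrite total_conductanceE//.
apply: (@le_trans _ _ (\sum_(u : 'I_d * bool) 1)).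
  by apply: ler_sum => u _; rewrite -env_bond_at.
by rewrite sumr_const card_prod card_ord card_bool mulnC.
Qed.

Lemma ae_total_conductance_le : iid_conductances Q omega -> conductances_in_01 Q omega ->
  {ae Q, forall t, forall x, total_conductance (omega t) x <= (2 * d)%:R}.
Proof.
move=> [env _ _ _] h01.
have H : {ae Q, forall t, forall n : nat,
    if (choice.unpickle n : option (bond d)) is Some b then conductance omega b t <= 1 else true}.
  apply: ae_foralln => n; case: (choice.unpickle n) => [b|]; last exact: aeW.
  by apply: filterS (h01 b) => t /andP[].
apply: filterS H => t H x; apply: total_conductance_le => // b.
by have := H (choice.pickle b); rewrite choice.pickleK.
Qed.

Lemma borel_cantelli_geometric (A : nat -> set T) (C z : R) :
  (forall i, measurable (A i)) -> (forall i, (Q (A i) <= (C * z ^+ i)%:E)%E) ->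
  0 <= C -> 0 <= z < 1 -> {ae Q, forall t, exists i1, forall i, (i1 <= i)%N -> ~ A i t}.
Proof.
move=> mA QA C0 /andP[z0 z1].
have z1' : 0 < 1 - z by rewrite subr_gt0.
have S : (\sum_(i <oo) Q (A i) < +oo)%E.
  apply: (@le_lt_trans _ _ (C / (1 - z))%:E); last exact: ltry.
  apply: lime_le; first by apply: is_cvg_nneseries => n _ _; exact: measure_ge0.
  apply: nearW => n; apply: (@le_trans _ _ (\sum_(0 <= i < n) (C * z ^+ i)%:E)%E).
    by apply: lee_sum => i _.
  rewrite sumEFin lee_fin big_mkord -mulr_sumr; apply: ler_wpM2l => //.
  rewrite -[leRHS]mul1r ler_pdivlMr//.
  have -> : (\sum_(i < n) z ^+ i) * (1 - z) = 1 - z ^+ n.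
    elim: n => [|n IH]; first by rewrite big_ord0 mul0r expr0 subrr.
    by rewrite big_ord_recr /= mulrDl IH exprS; ring.
  by rewrite gerBl exprn_ge0.
have N0 : Q (lim_sup_set A) = 0 by exact: lim_sup_set_cvg0.
have mL : measurable (lim_sup_set A).
  apply: bigcap_measurable; first by exists 0%N.
  by move=> k _; apply: bigcup_measurable => j _; exact: mA.
exists (lim_sup_set A); split => // t /= H k _; apply: contrapT => Hk; apply: H.
by exists k => i ki Ai; apply: Hk; exists i.
Qed.

End almost_sure.

Section dyadic.
Context {R : realType} {d : nat}.
Hypothesis d_gt0 : (0 < d)%N.
Variables (w : Zd d -> Zd d -> R).
Hypothesis env : environment w.
Hypothesis tc : forall x, total_conductance w x <= (2 * d)%:R.

(** The finitely many small n are absorbed in the constant. *)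
Lemma return_ge_large (n0 : nat) (c g : R) : 0 < c -> 0 <= g ->
  (forall n, (n0 <= n)%N -> (0 < n)%N -> c / n%:R `^ g <= transition_n w (2 * n) 0 0) ->
  exists2 C : R, 0 < C & forall n, (1 <= n)%N -> C / n%:R `^ g <= transition_n w (2 * n) 0 0.
Proof.
move=> c0 g0 H; pose b := total_conductance w 0 / (2 * d)%:R / ((2 * n0).+1 ^ d)%:R.
have b0 : 0 < b.
  rewrite !divr_gt0 ?total_conductance_gt0 ?ltr0n ?expn_gt0 ?muln_gt0//.
exists (Num.min c b); first by rewrite lt_min c0.
move=> n n1; have ng : 1 <= n%:R `^ g :> R.
  by rewrite -[leLHS](powRr0 (n%:R : R)) ler_powR// ler1n.
have ng0 : 0 < n%:R `^ g :> R by lra.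
have [nn0|nn0] := leqP n0 n.
  apply: le_trans (H n nn0 n1); rewrite ler_pM2r ?invr_gt0//.
  by rewrite ge_min lexx.
apply: (@le_trans _ _ b).
  rewrite ler_pdivrMr//; apply: (@le_trans _ _ b); first by rewrite ge_min lexx orbT.
  by rewrite ler_peMr// ltW.
apply: le_trans (return_ge_trivial d_gt0 n env tc); rewrite /b.
apply: ler_wpM2l; first by rewrite divr_ge0// ltW// total_conductance_gt0.
rewrite lef_pV2 ?posrE ?ltr0n ?expn_gt0// ler_nat leq_exp2r//.
by rewrite ltnS leq_mul2l ltnW ?orbT.
Qed.

(** The bound by the volume of the ball of radius n. *)
Lemma return_ge_pow : exists2 C : R, 0 < C &
  forall n, (1 <= n)%N -> C / n%:R `^ (2 + d%:R) <= transition_n w (2 * n) 0 0.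
Proof.
have t0 := total_conductance_gt0 d_gt0 env 0.
exists (total_conductance w 0 / (2 * d)%:R / 3 ^+ d).
  by rewrite !divr_gt0 ?exprn_gt0 ?ltr0n ?muln_gt0.
move=> n n1; apply: le_trans (return_ge_trivial d_gt0 n env tc).
rewrite -mulrA; apply: ler_wpM2l; first by rewrite divr_ge0// ltW.
have nR : 1 <= n%:R :> R by rewrite ler1n.
rewrite -invfM lef_pV2 ?posrE ?ltr0n ?expn_gt0 ?mulr_gt0 ?exprn_gt0 ?powR_gt0 ?(lt_le_trans ltr01 nR)//.
apply: (@le_trans _ _ (3 ^+ d * n%:R ^+ d)).
  rewrite natrX -exprMn; apply: lerXn2r; rewrite ?nnegrE//.
  by rewrite -natrM ler_nat; lia.
rewrite ler_wpM2l ?exprn_ge0// -powR_mulrn//; apply: ler_powR => //.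
by rewrite lerDr.
Qed.
End dyadic.

(** * The lower bound *)

Section small_gamma.
Context {R : realType} {d : nat} {disp : measure_display} {T : measurableType disp}.
Hypothesis d_gt1 : (1 < d)%N.
Variables (Q : probability T R) (omega : T -> Zd d -> Zd d -> R) (gamma : R).

Lemma ae_return_ge_traps : 0 < gamma -> (9 * d * d.+1)%:R * gamma < 1 ->
  iid_conductances Q omega -> conductances_in_01 Q omega -> lower_tail Q omega gamma ->
  {ae Q, forall t, exists2 C : R, 0 < C & forall n, (1 <= n)%N ->
    C / n%:R `^ (2 + (9 * d * d)%:R * gamma) <= transition_n (omega t) (2 * n) 0 0}.
Proof.
move=> g0 gs iid h01 tail.
have d_gt0 : (0 < d)%N by exact: ltnW.
have [C [c [i1 [C0 c0 H]]]] := scale_event d_gt1 g0 gs iid tail.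
have /choice[A AP] : forall j, exists A : set T, [/\ measurable A,
    (Q A <= (C * (2 `^ gamma)^-1 ^+ j)%:E)%E & forall t, ~ A t ->
    (forall x, total_conductance (omega t) x <= (2 * d)%:R) ->
    forall n, (4 ^ (i1 + j) <= n <= 4 * 4 ^ (i1 + j))%N ->
    c * total_conductance (omega t) 0 / (n%:R ^+ 2 * (n%:R `^ gamma) ^+ (9 * d * d))
    <= transition_n (omega t) (2 * n) 0 0].
  move=> j; have [A mA [QA AH]] := H (i1 + j)%N (leq_addr _ _).
  exists A; split => //; apply: le_trans QA _; rewrite lee_fin ler_wpM2l//.
  have th := theta_gt1 g0.
  rewrite !exprVn lef_pV2 ?posrE ?exprn_gt0 ?(lt_trans ltr01 th)//.
  by apply: ler_weXn2l; [exact: ltW|exact: leq_addl].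
have BC : {ae Q, forall t, exists j1, forall j, (j1 <= j)%N -> ~ A j t}.
  apply: (@borel_cantelli_geometric R disp T Q A C (2 `^ gamma)^-1) => //.
  - by move=> j; case: (AP j).
  - by move=> j; case: (AP j).
  - by rewrite invr_ge0 powR_ge0 invf_lt1 ?powR_gt0// theta_gt1.
have tcae := ae_total_conductance_le iid h01.
near=> t.
have tc : forall x, total_conductance (omega t) x <= (2 * d)%:R by near: t.
have [j1 Aj] : exists j1, forall j, (j1 <= j)%N -> ~ A j t by near: t.
have env : environment (omega t) by case: iid.
have t0 := total_conductance_gt0 d_gt0 env 0.
apply: (return_ge_large d_gt0 env tc (n0 := (4 ^ (i1 + j1))%N)
  (c := c * total_conductance (omega t) 0)); first exact: mulr_gt0.
  by rewrite addr_ge0// mulr_ge0// ltW.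
move=> n nn n0.
have /andP[m1 m2] := trunc_log_bounds (isT : (1 < 4)%N) n0.
have mi : (i1 + j1 <= trunc_log 4 n)%N by apply: trunc_log_max.
have [_ _ AH] := AP (trunc_log 4 n - i1)%N.
have E : (i1 + (trunc_log 4 n - i1) = trunc_log 4 n)%N.
  by rewrite subnKC// (leq_trans _ mi)// leq_addr.
have := AH t (Aj _ _) tc n; rewrite E m1 /= -expnS (ltnW m2) => /(_ _ isT).
have nR : 0 < n%:R :> R by rewrite ltr0n.
have -> : n%:R `^ (2 + (9 * d * d)%:R * gamma) =
    n%:R ^+ 2 * (n%:R `^ gamma) ^+ (9 * d * d) :> R.
  rewrite powRD; last by apply/implyP => _; rewrite gt_eqF.
  rewrite (@powR_mulrn R n%:R 2 (ler0n _ _)); congr (_ * _).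
  by rewrite mulrC powRrM powR_mulrn ?powR_ge0.
by apply; rewrite leq_subRL ?(leq_trans _ mi)// leq_addr.
Unshelve. all: by end_near.
Qed.
End small_gamma.

Unset Implicit Arguments.

Theorem theorem1p2 (R : realType) (d : nat) (hd : (5 <= d)%N) :
  exists delta : R -> R,
    [/\ forall gamma, 0 < gamma -> 0 < delta gamma,
        delta gamma @[gamma --> 0^'+] --> (0 : R) &
        forall (gamma : R), 0 < gamma ->
        forall (disp : measure_display) (T : measurableType disp)
          (Q : probability T R) (omega : T -> Zd d -> Zd d -> R),
          iid_conductances Q omega ->
          conductances_in_01 Q omega ->
          lower_tail Q omega gamma ->
          {ae Q, forall t, exists2 C : R, 0 < C &
            forall n : nat, (1 <= n)%N ->
              C / n%:R `^ (2 + delta gamma)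
                <= transition_n (omega t) (2 * n) 0 0}].
Proof.
have d_gt1 : (1 < d)%N by exact: leq_trans hd.
have d_gt0 : (0 < d)%N by exact: ltnW.
have K0 : 0 < (9 * d * d.+1)%:R :> R by rewrite ltr0n !muln_gt0 d_gt0.
have D0 : 0 < (9 * d * d)%:R :> R by rewrite ltr0n !muln_gt0 d_gt0.
(* Small gamma are those for which, at scale N, the volume of the ball times the
length of the strip is of smaller order than N^(1/2). *)
exists (fun gamma => if (9 * d * d.+1)%:R * gamma < 1 then (9 * d * d)%:R * gamma else d%:R).
split.
- by move=> gamma g0; case: ifP => _; [exact: mulr_gt0|rewrite ltr0n].
- apply/cvgrPdist_le => e e0; near=> gamma.
  have g0 : 0 < gamma by near: gamma; exact: nbhs_right_gt.
  have g1 : gamma < (9 * d * d.+1)%:R^-1.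
    by near: gamma; apply: nbhs_right_lt; rewrite invr_gt0.
  have g2 : gamma < e / (9 * d * d)%:R.
    by near: gamma; apply: nbhs_right_lt; rewrite divr_gt0.
  rewrite ifT; last by rewrite mulrC -ltr_pdivlMr// div1r.
  rewrite sub0r normrN ger0_norm ?mulr_ge0 ?(ltW D0) ?(ltW g0)//.
  by rewrite mulrC -ler_pdivlMr// ltW.
- move=> gamma g0 disp T Q omega iid h01 tail; case: ifP => gs.
    exact: ae_return_ge_traps.
  apply: filterS (ae_total_conductance_le iid h01) => t tc.
  by apply: return_ge_pow => //; case: iid.
Unshelve. all: by end_near.
Qed.
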